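(* Let $\mathbb K$ be $\mathbb C$ or $\mathbb R$, let $\mathfrak g$ be a semisimple Lie algebra over $\mathbb K$, let $V=\mathbb K^d$ be the abelian Lie algebra of dimension $d$, and let $\mathfrak L=\mathfrak g\times V$. Let $\delta\colon\mathfrak L\to\Lambda^2\mathfrak L$ be a Lie bialgebra structure on $\mathfrak L$, and let $\delta_{\mathfrak g}=(\pi_{\mathfrak g}\wedge\pi_{\mathfrak g})\circ\delta|_{\mathfrak g}$ be the induced Lie bialgebra structure on $\mathfrak g$, where $\pi_{\mathfrak g}\colon\mathfrak L\to\mathfrak g$ is the canonical projection. Assume that $(\mathfrak g,\delta_{\mathfrak g})$ is factorizable or (when $\mathbb K=\mathbb R$) almost factorizable. Put $\mathfrak g_{\mathbb C}=\mathfrak g$ if $\mathbb K=\mathbb C$ and $\mathfrak g_{\mathbb C}=\mathfrak g\otimes_{\mathbb R}\mathbb C$ if $\mathbb K=\mathbb R$, and assume that $\delta_{\mathfrak g}(x)=\mathrm{ad}_x(r)$ for all $x\in\mathfrak g$, with $r\in\mathfrak g_{\mathbb C}\otimes\mathfrak g_{\mathbb C}$ a Belavin–Drinfeld classical r-matrix with Cartan subalgebra $\mathfrak h\subset\mathfrak g_{\mathbb C}$ and BD-triple $(\Gamma_1,\Gamma_2,\tau)$. Then there exist a basis $\{t_1,\dots,t_d\}$ of $V$, linearly independent elements $H_1,\dots,H_{d_0}\in\mathfrak h\cap\mathfrak g$ ($0\le d_0\leq d$) satisfying $$\alpha(H_i)=\tau\alpha(H_i)\quad\forall\alpha\in\Gamma_1,\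 i=1,\dots,d_0,$$ such that for all $x\in\mathfrak g$ $$\delta(x)=\delta_{\mathfrak g}(x)+\sum_{i=1}^{d_0}[H_i,x]\wedge t_i=\mathrm{ad}_x\Big(r-\sum_{i=1}^{d_0}H_i\wedge t_i\Big),$$ and a Lie coalgebra structure $\delta_V\colon V\to\Lambda^2V$, with $\delta|_V=\delta_V$, satisfying $$\delta_Vt_1=\cdots=\delta_Vt_{d_0}=0.$$
   Context: A Lie bialgebra is a Lie algebra $\mathfrak g$ with a linear map $\delta\colon\mathfrak g\to\Lambda^2\mathfrak g$ satisfying co-Jacobi and the 1-cocycle condition $\delta[x,y]=\mathrm{ad}_x\delta(y)-\mathrm{ad}_y\delta(x)$. A Lie coalgebra is a vector space $V$ with a linear map $\delta_V\colon V\to\Lambda^2V$ satisfying co-Jacobi. $(\mathfrak g,\delta)$ is factorizable if there is $r\in\mathfrak g\otimes\mathfrak g$ with $\delta(x)=\mathrm{ad}_x(r)$ for all $x$, $[r^{12},r^{13}]+[r^{12},r^{23}]+[r^{13},r^{23}]=0$, and whose symmetric component induces a nondegenerate inner product on $\mathfrak g^*$. A real Lie bialgebra is almost factorizable if it is not factorizable but its complexification is factorizable. Semisimple Lie algebras are finite dimensional. Belavin–Drinfeld classical r-matrix on a complex semisimple Lie algebra $\mathfrak a$: fix a nondegenerate symmetric invariant bilinear form $(-,-)$ on $\mathfrak a$ with Casimir element $\Omega\in(S^2\mathfrak a)^{\mathfrak a}$, a Cartan subalgebra $\mathfrak h$, with root system $\Phi$, positive roots $\Phi^+$ and simple roots $\Delta$.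 A BD-triple $(\Gamma_1,\Gamma_2,\tau)$ consists of subsets $\Gamma_1,\Gamma_2\subseteq\Delta$ and a bijection $\tau\colon\Gamma_1\to\Gamma_2$ preserving the inner product such that for each $\alpha\in\Gamma_1$ there is a positive integer $n$ with $\tau^n(\alpha)\in\Gamma_2\setminus\Gamma_1$. Let $\widetilde\Gamma_i$ be the set of positive roots in the subgroup generated by $\Gamma_i$; extending $\tau$ additively, write $\alpha\prec\beta$ if $\alpha\in\widetilde\Gamma_1$, $\beta\in\widetilde\Gamma_2$ and $\beta=\tau^n(\alpha)$ for some positive integer $n$. A continuous parameter is $r_0\in\mathfrak h\otimes\mathfrak h$ with $(\tau(\alpha)\otimes\mathrm{id}+\mathrm{id}\otimes\alpha)r_0=0$ for all $\alpha\in\Gamma_1$ and $r_0+r_0^{21}=\Omega_0$, the $\mathfrak h\otimes\mathfrak h$-component of $\Omega$. Then $$r=r_0+\sum_{\alpha\in\Phi^+}x_{-\alpha}\otimes x_\alpha+\sum_{\alpha\in\Phi^+:\ \alpha\prec\beta}(x_{-\alpha}\otimes x_\beta-x_\beta\otimes x_{-\alpha}),$$ where $x_{\pm\alpha}\in\mathfrak a_{\pm\alpha}$ are root vectors with $(x_\alpha,x_{-\alpha})=1$. *)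

(* Defs.v *)
From HB Require Import structures.
From mathcomp Require Import all_boot all_order all_algebra.
From mathcomp Require Import boolp reals.
From mathcomp Require Import complex.
Set Implicit Arguments. Unset Strict Implicit. Unset Printing Implicit Defensive.
Import Order.TTheory GRing.Theory Num.Theory.
Local Open Scope ring_scope.

(* V (x) W is modelled by the matrices of coordinates with respect to the bases
   [vbasis fullv]; a bilinear map b on V x W extends to it as [tlift b], cf.
   [tlift_pure]. *)
Definition tens (K : fieldType) (V W : vectType K) : vectType K :=
  'M[K]_(\dim {:V}%VS, \dim {:W}%VS).

Definition ebase (K : fieldType) (V : vectType K) (i : 'I_(\dim {:V}%VS)) : V :=
  (vbasis {:V}%VS)`_i.

Definition ecoord (K : fieldType) (V : vectType K) (i : 'I_(\dim {:V}%VS))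
  (v : V) : K := coord (vbasis {:V}%VS) i v.

Definition pure (K : fieldType) (V W : vectType K) (v : V) (w : W) : tens V W :=
  \matrix_(i, j) (ecoord i v * ecoord j w).

Definition tlift (K : fieldType) (V W : vectType K) (U : lmodType K)
    (b : V -> W -> U) (t : tens V W) : U :=
  \sum_i \sum_j (t : 'M_(_, _)) i j *: b (ebase i) (ebase j).

Lemma ebase_sum (K : fieldType) (V : vectType K) (v : V) :
  v = \sum_i ecoord i v *: ebase i.
Proof. exact: coord_vbasis (memvf v). Qed.

Lemma tlift_pure (K : fieldType) (V W : vectType K) (U : lmodType K)
    (b : V -> W -> U) (v : V) (w : W) :
  (forall y, linear (b^~ y)) -> (forall x, linear (b x)) ->
  tlift b (pure v w) = b v w.
Proof.
move=> bl br.
have bD1 I (r : seq I) (c : I -> K) (x : I -> V) y :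
    b (\sum_(i <- r) c i *: x i) y = \sum_(i <- r) c i *: b (x i) y.
  elim: r => [|i r IHr]; last by rewrite !big_cons bl IHr.
  by rewrite !big_nil -[0](subrr (0 : V)) addrC -scaleN1r bl scaleN1r addNr.
have bD2 I (r : seq I) (c : I -> K) x (y : I -> W) :
    b x (\sum_(i <- r) c i *: y i) = \sum_(i <- r) c i *: b x (y i).
  elim: r => [|i r IHr]; last by rewrite !big_cons br IHr.
  by rewrite !big_nil -[0](subrr (0 : W)) addrC -scaleN1r br scaleN1r addNr.
rewrite {2}[v]ebase_sum bD1 /tlift; apply: eq_bigr => i _.
rewrite {2}[w]ebase_sum bD2 scaler_sumr; apply: eq_bigr => j _.
by rewrite mxE scalerA.
Qed.

Definition tmap (K : fieldType) (V W V' W' : vectType K)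
    (f : V -> V') (g : W -> W') : tens V W -> tens V' W' :=
  tlift (fun v w => pure (f v) (g w)).

Definition flip (K : fieldType) (V : vectType K) : tens V V -> tens V V :=
  tlift (fun v w => pure w v).

(* Lambda^2 V is identified with the antisymmetric tensors of V (x) V, with the
   normalization v /\ w = v (x) w - w (x) v. *)
Definition wedge (K : fieldType) (V : vectType K) (v w : V) : tens V V :=
  pure v w - pure w v.

Definition in_Lambda2 (K : fieldType) (V : vectType K) (t : tens V V) : Prop :=
  flip t = - t.

Definition cyc3 (K : fieldType) (V : vectType K) :
    tens V (tens V V) -> tens V (tens V V) :=
  tlift (fun u => tlift (fun v w => pure v (pure w u))).

Definition dual (K : fieldType) (V : vectType K) : vectType K := 'Hom(V, K^o).

(* The bilinear form (phi, psi) |-> (phi (x) psi)(t) induced by t on the dual. *)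
Definition tform (K : fieldType) (V : vectType K) (t : tens V V)
    (phi psi : dual V) : K :=
  tlift (fun v w => phi v * psi w : K^o) t.


Record lieAlg (K : fieldType) := LieAlg {
  lie_car :> vectType K;
  br : lie_car -> lie_car -> lie_car;
  br_linl : forall y, linear (br^~ y);
  br_linr : forall x, linear (br x);
  br_alt : forall x, br x x = 0;
  br_jacobi : forall x y z, br x (br y z) + br y (br z x) + br z (br x y) = 0
}.

Definition is_ideal (K : fieldType) (g : lieAlg K) (I : {vspace g}) : Prop :=
  forall x y : g, y \in I -> br x y \in I.

Definition derived (K : fieldType) (g : lieAlg K) (U : {vspace g}) : {vspace g} :=
  <<[seq br x y | x <- vbasis U, y <- vbasis U]>>%VS.

Definition solvable (K : fieldType) (g : lieAlg K) (U : {vspace g}) : Prop :=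
  exists n, iter n (@derived K g) U = 0%VS.

Definition semisimple (K : fieldType) (g : lieAlg K) : Prop :=
  forall I : {vspace g}, is_ideal I -> solvable I -> I = 0%VS.

Program Definition lie_prod_abelian (K : fieldType) (g : lieAlg K)
    (V : vectType K) : lieAlg K :=
  @LieAlg K (g * V)%type (fun a b => (br a.1 b.1, 0)) _ _ _ _.
Next Obligation. by move=> a x x'; congr pair; rewrite /= ?br_linl ?scaler0 ?addr0. Qed.
Next Obligation. by move=> a y y'; congr pair; rewrite /= ?br_linr ?scaler0 ?addr0. Qed.
Next Obligation. by rewrite /= br_alt. Qed.
Next Obligation. by congr pair; rewrite /= ?br_jacobi ?addr0. Qed.

Definition kvec (K : fieldType) (d : nat) : vectType K := 'rV[K]_d.

Definition inG (K : fieldType) (g : lieAlg K) (V : vectType K) (x : g) :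
  lie_prod_abelian g V := (x, 0).
Definition inV (K : fieldType) (g : lieAlg K) (V : vectType K) (v : V) :
  lie_prod_abelian g V := (0, v).
Definition prG (K : fieldType) (g : lieAlg K) (V : vectType K)
  (a : lie_prod_abelian g V) : g := a.1.

Definition ad2 (K : fieldType) (g : lieAlg K) (x : g) : tens g g -> tens g g :=
  tlift (fun a b => pure (br x a) b + pure a (br x b)).


Definition lie_coalgebra (K : fieldType) (V : vectType K) (delta : V -> tens V V) :=
  [/\ linear delta,
      forall v, in_Lambda2 (delta v)
    & forall v, let t := tlift (fun a b => pure a (delta b)) (delta v) in
        t + cyc3 t + cyc3 (cyc3 t) = 0].

Definition lie_bialgebra (K : fieldType) (g : lieAlg K) (delta : g -> tens g g) :=
  lie_coalgebra delta /\
  forall x y : g, delta (br x y) = ad2 x (delta y) - ad2 y (delta x).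

Definition CYB (K : fieldType) (g : lieAlg K) (r : tens g g) : tens g (tens g g) :=
  tlift (fun a b => tlift (fun c d =>
       pure (br a c) (pure b d)      (* [r12, r13] *)
     + pure a (pure (br b c) d)      (* [r12, r23] *)
     + pure a (pure c (br b d)))     (* [r13, r23] *)
    r) r.

Definition sym_part (K : fieldType) (V : vectType K) (t : tens V V) : tens V V :=
  2%:R^-1 *: (t + flip t).

Definition factorizable (K : fieldType) (g : lieAlg K) (delta : g -> tens g g) :=
  exists r : tens g g,
    [/\ forall x, delta x = ad2 x r,
        CYB r = 0
      & forall phi : dual g,
          (forall psi, tform (sym_part r) phi psi = 0) -> phi = 0].

Definition delta_g (K : fieldType) (g : lieAlg K) (V : vectType K)
    (delta : lie_prod_abelian g V -> tens (lie_prod_abelian g V) (lie_prod_abelian g V))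
    (x : g) : tens g g :=
  tmap (@prG K g V) (@prG K g V) (delta (inG V x)).

(* The complexification of V in coordinates: [vbasis fullv] of V becomes the
   canonical basis of the row vectors. *)
Definition cplx (R : realType) (V : vectType R) : vectType R[i] :=
  'rV[R[i]]_(\dim {:V}%VS).

Definition toC (R : realType) (V : vectType R) (v : V) : cplx V :=
  \row_i (ecoord i v)%:C%C.

(* The C-linear extension to cplx V of an R-linear f. *)
Definition clift (R : realType) (V : vectType R) (U : lmodType R[i])
    (f : V -> U) (u : cplx V) : U :=
  \sum_i (u : 'rV_(_)) 0 i *: f (ebase i).

Definition cmap (R : realType) (V W : vectType R) (f : V -> W) :
  cplx V -> cplx W := clift (fun v => toC (f v)).

(* The canonical map V (x) W -> (cplx V) (x) (cplx W). *)
Definition toC2 (R : realType) (V W : vectType R) (t : tens V W) :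
    tens (cplx V) (cplx W) :=
  \sum_i \sum_j ((t : 'M_(_, _)) i j)%:C%C *: pure (toC (ebase i)) (toC (ebase j)).

Definition cbr (R : realType) (g : lieAlg R) (u v : cplx g) : cplx g :=
  clift (fun x => clift (fun y => toC (br x y)) v) u.

Section CplxLie.
Variables (R : realType) (g : lieAlg R).

Lemma clift_linear (V : vectType R) (U : lmodType R[i]) (f : V -> U) :
  linear (clift f).
Proof.
move=> a u v; rewrite /clift scaler_sumr -big_split; apply: eq_bigr => i _ /=.
by rewrite !mxE scalerDl scalerA.
Qed.

Lemma cbr_linl (v : cplx g) : linear ((@cbr R g)^~ v).
Proof. by move=> a u u'; rewrite /cbr clift_linear. Qed.

Lemma cbr_linr (u : cplx g) : linear (@cbr R g u).
Proof.
have E v : cbr u v =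
  \sum_i (u : 'rV_(_)) 0 i *: clift (fun y => toC (br (ebase i) y)) v by [].
move=> a v v'; rewrite !E scaler_sumr -big_split.
apply: eq_bigr => i _ /=.
by rewrite clift_linear scalerDr !scalerA [a * _]mulrC.
Qed.

Lemma toC_linear (V : vectType R) (a : R) (x y : V) :
  toC (a *: x + y) = a%:C%C *: toC x + toC y.
Proof. by apply/rowP => i; rewrite !mxE /ecoord linearP rmorphD rmorphM. Qed.

Lemma toC0 (V : vectType R) : toC (0 : V) = 0.
Proof. by apply/rowP => i; rewrite !mxE /ecoord linear0 rmorph0. Qed.

Lemma toCD (V : vectType R) (x y : V) : toC (x + y) = toC x + toC y.
Proof. by apply/rowP => i; rewrite !mxE /ecoord linearD rmorphD. Qed.

Lemma toCZ (V : vectType R) (a : R) (x : V) : toC (a *: x) = a%:C%C *: toC x.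
Proof. by rewrite -[a *: x]addr0 toC_linear toC0 addr0. Qed.

Lemma toC_sum (V : vectType R) I (r : seq I) (P : pred I) (F : I -> V) :
  toC (\sum_(i <- r | P i) F i) = \sum_(i <- r | P i) toC (F i).
Proof. exact: (big_morph _ (@toCD V) (toC0 V)). Qed.

Lemma toC_ebase (V : vectType R) (i : 'I_(\dim {:V}%VS)) :
  toC (ebase i) = delta_mx 0 i.
Proof.
apply/rowP => j; rewrite !mxE /ecoord /ebase coord_free ?(basis_free (vbasisP _)) //.
by rewrite eqxx; case: eqVneq.
Qed.

Lemma cplx_sum (V : vectType R) (u : cplx V) :
  u = \sum_i (u : 'rV_(_)) 0 i *: toC (ebase i).
Proof.
rewrite [LHS](row_sum_delta u); apply: eq_bigr => i _; by rewrite toC_ebase.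
Qed.

Lemma clift_toC (V W : vectType R) (f : V -> W) (v : V) :
  linear f -> clift (fun x => toC (f x)) (toC v) = toC (f v).
Proof.
move=> fl; have f0 : f 0 = 0.
  by have := fl (-1) 0 0; rewrite scaler0 addr0 scaleN1r addNr.
have fS I (r : seq I) (c : I -> R) (x : I -> V) :
    f (\sum_(i <- r) c i *: x i) = \sum_(i <- r) c i *: f (x i).
  by elim: r => [|i r IHr]; rewrite ?big_nil ?f0 // !big_cons fl IHr.
rewrite {2}[v]ebase_sum fS toC_sum; apply: eq_bigr => i _.
by rewrite mxE toCZ.
Qed.

Lemma cbr_toC (x y : g) : cbr (toC x) (toC y) = toC (br x y).
Proof.
rewrite /cbr -(clift_toC x (@br_linl R g y)) /clift; apply: eq_bigr => i _.
by rewrite -[in RHS](clift_toC y (@br_linr R g _)).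
Qed.

Lemma cbr_alt (u : cplx g) : cbr u u = 0.
Proof.
have anti (x y : g) : br x y = - br y x.
  have brD z a b : br z (a + b) = br z a + br z b.
    by rewrite -[a in LHS](scale1r a) br_linr scale1r.
  have brDl z a b : br (a + b) z = br a z + br b z.
    by rewrite -[a in LHS](scale1r a) br_linl scale1r.
  apply/eqP; rewrite -addr_eq0; apply/eqP.
  by have := br_alt (x + y); rewrite brD !brDl !br_alt add0r addr0 addrC.
have cN : cbr u u = - cbr u u.
  rewrite {1}/cbr /clift; under eq_bigr do rewrite scaler_sumr.
  rewrite exchange_big /= /cbr /clift -sumrN; apply: eq_bigr => i _.
  rewrite scaler_sumr -sumrN; apply: eq_bigr => j _.
  rewrite !scalerA mulrC anti -scalerN; congr (_ *: _).
  by apply/rowP => k; rewrite !mxE /ecoord linearN rmorphN.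
apply/eqP; have /eqP : cbr u u + cbr u u = 0 by rewrite {2}cN subrr.
by rewrite -mulr2n -scaler_nat scaler_eq0 pnatr_eq0.
Qed.

Lemma cbr_jacobi (u v w : cplx g) :
  cbr u (cbr v w) + cbr v (cbr w u) + cbr w (cbr u v) = 0.
Proof.
have z0 (F : cplx g -> cplx g) : linear F -> F 0 = 0.
  by move=> Fl; have := Fl (-1) 0 0; rewrite scaler0 addr0 scaleN1r addNr.
have ext (F : cplx g -> cplx g) : linear F -> (forall x, F (toC x) = 0) ->
    forall u, F u = 0.
  move=> Fl F0 {}u; rewrite [u]cplx_sum.
  elim: (index_enum _) => [|i r IHr]; first by rewrite big_nil z0.
  by rewrite big_cons Fl F0 IHr scaler0 addr0.
have D (F G H : cplx g -> cplx g) : linear F -> linear G -> linear H ->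
    linear (fun u => F u + G u + H u).
  move=> lF lG lH a x y; rewrite lF lG lH !scalerDr.
  by rewrite (addrACA (a *: F x)) [LHS]addrACA.
have lrr (a b : cplx g) : linear (fun u => cbr a (cbr b u)).
  by move=> k x y; rewrite !cbr_linr.
have lrl (a b : cplx g) : linear (fun u => cbr a (cbr u b)).
  by move=> k x y; rewrite cbr_linl cbr_linr.
move: u; apply: (ext _) => [|x].
  exact: (D _ _ _ (@cbr_linl _) (lrr v w) (lrl w v)).
move: v; apply: (ext _) => [|y].
  exact: (D _ _ _ (lrl (toC x) w) (@cbr_linl _) (lrr w (toC x))).
move: w; apply: (ext _) => [|z].
  exact: (D _ _ _ (lrr (toC x) (toC y)) (lrl (toC y) (toC x)) (@cbr_linl _)).
by rewrite !cbr_toC -!toCD br_jacobi toC0.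
Qed.

Definition cplx_lie : lieAlg R[i] :=
  LieAlg cbr_linl cbr_linr cbr_alt cbr_jacobi.

End CplxLie.

Definition cplx_delta (R : realType) (g : lieAlg R) (delta : g -> tens g g) :
    cplx_lie g -> tens (cplx_lie g) (cplx_lie g) :=
  clift (fun x => toC2 (delta x)).

Definition almost_factorizable (R : realType) (g : lieAlg R)
    (delta : g -> tens g g) : Prop :=
  ~ factorizable delta /\ factorizable (cplx_delta delta).


Record inv_form (K : fieldType) (a : lieAlg K) (B : a -> a -> K) : Prop := {
  inv_form_linl : forall y, linear (B^~ y : a -> K^o);
  inv_form_sym : forall x y, B x y = B y x;
  inv_form_inv : forall x y z, B (br x y) z = B x (br y z);
  inv_form_nondeg : forall x, (forall y, B x y = 0) -> x = 0
}.

(* sum_i e_i (x) e^i for the basis (e_i) = vbasis fullv and its B-dual basis: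
   the coordinates form the inverse Gram matrix. *)
Definition casimir (K : fieldType) (a : lieAlg K) (B : a -> a -> K) : tens a a :=
  invmx (\matrix_(i, j) B (ebase i) (ebase j)).

(* The usual definition for complex semisimple Lie algebras: a toral subalgebra
   equal to its own centralizer. *)
Record cartan (K : fieldType) (a : lieAlg K) (h : {vspace a}) : Prop := {
  cartan_abelian : forall x y, x \in h -> y \in h -> br x y = 0;
  cartan_diag : forall x, x \in h ->
    exists b : (\dim {:a}%VS).-tuple a,
      basis_of {:a}%VS b /\ forall i, exists c : K, br x (tnth b i) = c *: tnth b i;
  cartan_selfcentral : forall x, (forall y, y \in h -> br y x = 0) -> x \in h
}.

Section BD.
Variables (K : fieldType) (a : lieAlg K) (h : {vspace a}).

(* h as a vector space in its own right; [vsval] is the inclusion in a and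
   [vsproj h] is inverse to it on h. *)
Definition hsub : vectType K := subvs_of h.

Definition rspace (al : dual hsub) : {vspace a} :=
  (\bigcap_(i < \dim h)
     passmx.leigenspace (linfun (br (vbasis h)`_i)) (al (vsproj h (vbasis h)`_i)))%VS.

Lemma mem_rspace (al : dual hsub) (x : a) :
  x \in rspace al <-> forall H : hsub, br (vsval H) x = al H *: x.
Proof.
have bl (y : a) : linear (fun z : a => br z y) by exact: br_linl.
have adE (H y : a) : linfun (br H) y = br H y.
  pose L := GRing.isLinear.Build K a a _ (br H) (@br_linr K a H).
  pose f : {linear a -> a} := HB.pack (@br K a H) L.
  exact: (lfunE f y).
have eigE (H : a) (c : K) y :
    (y \in passmx.leigenspace (linfun (br H)) c) = (br H y == c *: y).
  by rewrite memv_ker add_lfunE opp_lfunE scale_lfunE id_lfunE adE subr_eq0.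
rewrite memvE; split=> [/subv_bigcapP xh H|xh]; last first.
  apply/subv_bigcapP => i _; rewrite -memvE eigE; apply/eqP.
  have hi : (vbasis h)`_i \in h by rewrite vbasis_mem ?mem_nth ?size_tuple.
  by rewrite -[X in br X](vsprojK hi) xh.
have xh' (i : 'I_(\dim h)) : br (vbasis h)`_i x = al (vsproj h (vbasis h)`_i) *: x.
  by apply/eqP; rewrite -eigE memvE xh.
have HE := coord_vbasis (valP H : vsval H \in h).
have sumE (c : 'I_(\dim h) -> K) r :
    br (\sum_(i <- r) c i *: (vbasis h)`_i) x =
    al (vsproj h (\sum_(i <- r) c i *: (vbasis h)`_i)) *: x.
  elim: r => [|i r IHr].
    rewrite !big_nil !linear0 scale0r.
    by have := bl x (-1) 0 0; rewrite scaler0 addr0 scaleN1r addNr.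
  by rewrite !big_cons bl IHr xh' !linearP /= scalerDl scalerA.
by rewrite HE sumE -HE vsvalK.
Qed.

Definition is_root (al : dual hsub) : Prop := al != 0 /\ rspace al != 0%VS.

Definition enumerates_roots (Phi : seq (dual hsub)) : Prop :=
  uniq Phi /\ forall al, al \in Phi <-> is_root al.

Section Simple.
Variables (l : nat) (Delta : l.-tuple (dual hsub)).

Definition positive (al : dual hsub) : Prop :=
  exists c : 'I_l -> nat, al = \sum_(i < l) Delta`_i *+ c i.

Definition simple_roots (Phi : seq (dual hsub)) : Prop :=
  [/\ basis_of {:dual hsub}%VS Delta,
      {subset Delta <= Phi}
    & forall al, al \in Phi -> positive al \/ positive (- al)].

Definition pos_roots (Phi : seq (dual hsub)) : seq (dual hsub) :=
  [seq al <- Phi | `[< positive al >]].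

(* The projection of a on h along the sum of the root spaces. *)
Definition hproj (Phi : seq (dual hsub)) (x : a) : hsub :=
  vsproj h (daddv_pi h (\sum_(al <- Phi) rspace al)%VS x).

(* The component of the Casimir element in h (x) h; [tform] of it is the
   inner product induced by B on the dual of h. *)
Definition Omega0 (B : a -> a -> K) (Phi : seq (dual hsub)) : tens hsub hsub :=
  tmap (hproj Phi) (hproj Phi) (casimir B).

(* Subsets of Delta are given by sets of indices; only the restriction of tau
   to G1 is meaningful. *)
Variables (G1 G2 : {set 'I_l}) (tau : 'I_l -> 'I_l).

Record BD_triple (B : a -> a -> K) (Phi : seq (dual hsub)) : Prop := {
  BD_inj : {in G1 &, injective tau};
  BD_surj : [set tau i | i in G1] = G2;
  BD_isom : forall i j, i \in G1 -> j \in G1 ->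
    tform (Omega0 B Phi) Delta`_(tau i) Delta`_(tau j)
    = tform (Omega0 B Phi) Delta`_i Delta`_j;
  (* tau^n(i) is defined when the previous iterates are in G1 *)
  BD_nilp : forall i, i \in G1 -> exists n, [/\ (0 < n)%N,
    forall k, (k < n)%N -> iter k tau i \in G1
    & iter n tau i \in G2 :\: G1]
}.

Definition in_span (G : {set 'I_l}) (al : dual hsub) : Prop :=
  exists c : 'I_l -> int, al = \sum_(i < l | i \in G) Delta`_i *~ c i.

Definition in_Gtilde (Phi : seq (dual hsub)) (G : {set 'I_l}) (al : dual hsub) :=
  al \in pos_roots Phi /\ in_span G al.

(* The additive extension of tau to the subgroup generated by G1 (its values
   outside this subgroup are irrelevant). *)
Definition tau_ext (al : dual hsub) : dual hsub :=
  \sum_(i < l | i \in G1) coord Delta i al *: Delta`_(tau i).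

Definition prec (Phi : seq (dual hsub)) (al be : dual hsub) : Prop :=
  [/\ in_Gtilde Phi G1 al, in_Gtilde Phi G2 be
    & exists n, [/\ (0 < n)%N,
        forall k, (k < n)%N -> in_span G1 (iter k tau_ext al)
        & be = iter n tau_ext al]].

Definition cont_param (B : a -> a -> K) (Phi : seq (dual hsub))
    (r0 : tens hsub hsub) : Prop :=
  (forall i, i \in G1 ->
     tlift (fun u v => Delta`_(tau i) u *: v + Delta`_i v *: u) r0 = 0) /\
  r0 + flip r0 = Omega0 B Phi.

Definition root_vectors (B : a -> a -> K) (Phi : seq (dual hsub))
    (x : dual hsub -> a) : Prop :=
  (forall al, al \in Phi -> x al \in rspace al) /\
  (forall al, al \in pos_roots Phi -> B (x al) (x (- al)) = 1).

Definition BD_formula (Phi : seq (dual hsub)) (r0 : tens hsub hsub)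
    (x : dual hsub -> a) : tens a a :=
  tmap (fun u : hsub => vsval u) (fun u : hsub => vsval u) r0
  + \sum_(al <- pos_roots Phi) pure (x (- al)) (x al)
  + \sum_(al <- pos_roots Phi) \sum_(be <- pos_roots Phi | `[< prec Phi al be >])
      (pure (x (- al)) (x be) - pure (x be) (x (- al))).

Definition BD_rmatrix (r : tens a a) : Prop :=
  exists (B : a -> a -> K) (Phi : seq (dual hsub)) (r0 : tens hsub hsub)
         (x : dual hsub -> a),
    [/\ inv_form B, cartan h
      & enumerates_roots Phi] /\
    [/\ simple_roots Phi, BD_triple B Phi, cont_param B Phi r0,
        root_vectors B Phi x
      & r = BD_formula Phi r0 x].

End Simple.
End BD.

(* Main.v *)
Require Import Defs.
From HB Require Import structures.
From mathcomp Require Import all_boot all_order all_algebra.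
From mathcomp Require Import boolp reals.
From mathcomp Require Import complex ring.
Set Implicit Arguments. Unset Strict Implicit. Unset Printing Implicit Defensive.
Import Order.TTheory GRing.Theory Num.Theory.
Local Open Scope ring_scope.

(** Write L = g x V, so that L (x) L splits into g (x) g, g (x) V, V (x) g and
    V (x) V.

    The elements of V are central, so the cocycle condition makes delta(v)
    ad-invariant for every v in V.  Since g has trivial centre and no nonzero
    antisymmetric invariant tensor, delta(v) lies in V (x) V; this is delta_V.
    For x in g, the V (x) V component of delta(x) vanishes on brackets, hence
    everywhere, and each coordinate of the g (x) V component is a derivation of
    g, hence of the form [Z_j, x].  The component of the co-Jacobi identity in
    V (x) g (x) g says that ad(Z_j) is a coderivation of delta_g; against the
    cocycle condition this gives ad_x delta_g(Z_j) = 0 for all x, that is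
    delta_g(Z_j) = 0.  As the zeros of delta_g commute, the component in
    g (x) V (x) V reduces to sum_j Z_j (x) delta_V(e_j) = 0.  A rank
    factorization of the matrix of the Z_j then gives the H_i and the basis t
    at once ([product_structure]).

    What is used about g therefore is: trivial centre, perfectness, absence of
    antisymmetric invariants, inner derivations, and the description of the
    zeros of delta_g = ad(r).  [BD_structure] derives all of it from the data of
    the r-matrix, that is, from an invariant form B, a Cartan subalgebra h and
    the shape of r.
    - S = r + r^21 is ad-invariant, and contraction with B turns it into an
      operator commuting with ad which is the identity on h; so it is the
      identity ([ctr_symr]).  Expanding S shows that every element is a
      combination of h and of the chosen root vectors x_(+-al)
      ([root_expansion]).
    - With t_al = [x_al, x_-al], the trace of ad(t_al) on a root string vanishes,
      so that be(t_al) is a rational multiple of al(t_al)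
      ([root_string_ratio]).  Hence al(t_al) <> 0, and the Casimir operator C of
      the adjoint representation, C z = sum_S [u, [v, z]], satisfies
      B(C t_al, t_al) = 2 sum_be be(t_al)^2 <> 0.  This makes C bijective
      ([casop_surj]), and the usual averaging argument with S proves that
      derivations are inner and that a is perfect.
    - If ad_Z(r) = 0, then ad(Z) commutes with the operator y |-> (B(y, .) (x) id) r.
      Comparing both orders of composition on h yields, for c_ga = B(Z, x_-ga),
      the relation ga(f y) c_ga = ga(y) c_ga + sum_(al < ga) al(y) c_al, where f
      is the contraction of r0.  The order being well founded, induction gives
      c_ga = 0; likewise B(Z, x_ga) = 0, so that Z is in h ([zero_in_h]).
      Applying the two operators to the root vector of a simple root al in
      Gamma_1 gives al(Z) = (tau al)(Z) ([zero_tau]).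

    Over the reals the first four properties descend from the complexification
    of g, inner derivations by taking real parts; the fifth is applied to the
    images of the H_i in the complexification. *)

(** * Tensors and brackets *)

Section Tensors.
Variable K : fieldType.

Definition bilin (V W U : lmodType K) (b : V -> W -> U) : Prop :=
  (forall y, linear (b^~ y)) /\ (forall x, linear (b x)).

Lemma ecoord_linear (V : vectType K) (i : 'I_(\dim {:V}%VS)) : linear (@ecoord K V i : V -> K^o).
Proof. by move=> a x y; rewrite /ecoord linearP. Qed.

Lemma ecoord_ebase (V : vectType K) (i j : 'I_(\dim {:V}%VS)) :
  ecoord i (ebase j : V) = (i == j)%:R.
Proof. by rewrite /ecoord /ebase coord_free ?(basis_free (vbasisP _)) // eq_sym. Qed.

Lemma ecoordP (V : vectType K) (x y : V) : (forall i, ecoord i x = ecoord i y) -> x = y.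
Proof. by move=> e; rewrite [x]ebase_sum [y]ebase_sum; apply: eq_bigr => i _; rewrite e. Qed.

Section Pure.
Variables V W : vectType K.

Lemma bilin_pure : bilin (@pure K V W : V -> W -> tens V W).
Proof.
split=> [w a x y|v a x y]; apply/matrixP => i j; rewrite !mxE ecoord_linear.
  by rewrite mulrDl -mulrA.
by rewrite mulrDr mulrCA.
Qed.

Lemma tlift_linear (U : lmodType K) (b : V -> W -> U) : linear (tlift b).
Proof.
move=> a s t; rewrite /tlift scaler_sumr -big_split; apply: eq_bigr => i _ /=.
rewrite scaler_sumr -big_split; apply: eq_bigr => j _ /=.
by rewrite !mxE scalerDl scalerA.
Qed.

HB.instance Definition _ (U : lmodType K) (b : V -> W -> U) :=
  GRing.isLinear.Build K (tens V W) U _ (tlift b) (tlift_linear b).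

Lemma tlift_id (t : tens V W) : tlift (@pure K V W) t = t.
Proof.
rewrite [RHS]matrix_sum_delta; apply: eq_bigr => i _; apply: eq_bigr => j _.
congr (_ *: _); apply/matrixP => k l; rewrite !mxE !ecoord_ebase.
by case: (k == i); case: (l == j); rewrite ?mulr1 ?mulr0.
Qed.

Lemma eq_tlift (U : lmodType K) (b b' : V -> W -> U) (t : tens V W) :
  (forall v w, b v w = b' v w) -> tlift b t = tlift b' t.
Proof. by move=> e; apply: eq_bigr => i _; apply: eq_bigr => j _; rewrite e. Qed.

(** The main computation rule for operations on tensors: every one of them is
    a [tlift], so identities between them reduce to identities on pairs of
    vectors. *)
Lemma linear_tlift (U U' : lmodType K) (F : U -> U') (b : V -> W -> U) t :
  linear F -> F (tlift b t) = tlift (fun v w => F (b v w)) t.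
Proof.
move=> Fl; pose f : {linear U -> U'} :=
  HB.pack F (GRing.isLinear.Build K U U' _ F Fl).
rewrite -[F]/(f : U -> U') linear_sum; apply: eq_bigr => i _.
by rewrite linear_sum; apply: eq_bigr => j _; rewrite linearZ.
Qed.

Lemma tliftP (U : lmodType K) (b : V -> W -> U) v w :
  bilin b -> tlift b (pure v w) = b v w.
Proof. by case=> bl br; rewrite tlift_pure. Qed.

Lemma tlift_add (U : lmodType K) (b b' : V -> W -> U) t :
  tlift (fun v w => b v w + b' v w) t = tlift b t + tlift b' t.
Proof.
rewrite /tlift -big_split; apply: eq_bigr => i _ /=.
by rewrite -big_split; apply: eq_bigr => j _ /=; rewrite scalerDr.
Qed.

Lemma tlift_opp (U : lmodType K) (b : V -> W -> U) t :
  tlift (fun v w => - b v w) t = - tlift b t.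
Proof.
rewrite /tlift -sumrN; apply: eq_bigr => i _ /=.
by rewrite -sumrN; apply: eq_bigr => j _ /=; rewrite scalerN.
Qed.

Lemma tlift_scale (U : lmodType K) (b : V -> W -> U) c t :
  tlift (fun v w => c *: b v w) t = c *: tlift b t.
Proof.
rewrite /tlift scaler_sumr; apply: eq_bigr => i _.
by rewrite scaler_sumr; apply: eq_bigr => j _; rewrite !scalerA mulrC.
Qed.

Lemma tlift0 (U : lmodType K) (t : tens V W) : tlift (fun _ _ => 0 : U) t = 0.
Proof. by rewrite /tlift big1 // => i _; rewrite big1 // => j _; rewrite scaler0. Qed.

Lemma tlift_sum (U : lmodType K) I (s : seq I) (P : pred I)
    (b : I -> V -> W -> U) t :
  tlift (fun v w => \sum_(i <- s | P i) b i v w) t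
  = \sum_(i <- s | P i) tlift (b i) t.
Proof.
elim: s => [|i s IHs].
  by rewrite big_nil -[RHS](tlift0 U t); apply: eq_tlift => v w; rewrite big_nil.
rewrite big_cons -IHs; case: ifP => Pi; rewrite -?tlift_add;
  by apply: eq_tlift => v w; rewrite big_cons Pi.
Qed.

End Pure.

Lemma tlift_tmap (V W V' W' : vectType K) (U : lmodType K)
    (b : V' -> W' -> U) (f : V -> V') (g : W -> W') t :
  bilin b -> tlift b (tmap f g t) = tlift (fun v w => b (f v) (g w)) t.
Proof.
move=> bl; rewrite /tmap (linear_tlift _ _ (tlift_linear b)).
by apply: eq_tlift => v w; rewrite tliftP.
Qed.

Lemma tlift_flip (V : vectType K) (U : lmodType K) (b : V -> V -> U) t :
  bilin b -> tlift b (flip t) = tlift (fun v w => b w v) t.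
Proof.
move=> bl; rewrite /flip (linear_tlift _ _ (tlift_linear b)).
by apply: eq_tlift => v w; rewrite tliftP.
Qed.

Lemma tlift_ad2 (g : lieAlg K) (U : lmodType K) (b : g -> g -> U) x t :
  bilin b ->
  tlift b (ad2 x t) = tlift (fun v w => b (br x v) w + b v (br x w)) t.
Proof.
move=> bl; rewrite /ad2 (linear_tlift _ _ (tlift_linear b)).
by apply: eq_tlift => v w; rewrite linearD /= !tliftP.
Qed.

Lemma tmap_linear (V W V' W' : vectType K) (f : V -> V') (g : W -> W') :
  linear (tmap f g).
Proof. exact: tlift_linear. Qed.
HB.instance Definition _ (V W V' W' : vectType K) (f : V -> V') (g : W -> W') :=
  GRing.isLinear.Build K (tens V W) (tens V' W') _ (tmap f g) (tmap_linear f g).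

Lemma flip_linear (V : vectType K) : linear (@flip K V).
Proof. exact: tlift_linear. Qed.
HB.instance Definition _ (V : vectType K) :=
  GRing.isLinear.Build K (tens V V) (tens V V) _ (@flip K V) (@flip_linear V).

Lemma ad2_linear (g : lieAlg K) (x : g) : linear (@ad2 K g x).
Proof. exact: tlift_linear. Qed.
HB.instance Definition _ (g : lieAlg K) (x : g) :=
  GRing.isLinear.Build K (tens g g) (tens g g) _ (@ad2 K g x) (ad2_linear x).

HB.instance Definition _ (g : lieAlg K) (x : g) :=
  GRing.isLinear.Build K g g _ (br x) (br_linr x).

Lemma brNr (g : lieAlg K) (x y : g) : br x (- y) = - br x y.
Proof. exact: linearN. Qed.

Lemma brDr (g : lieAlg K) (x y z : g) : br x (y + z) = br x y + br x z.
Proof. exact: linearD. Qed.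

Lemma brZr (g : lieAlg K) a (x y : g) : br x (a *: y) = a *: br x y.
Proof. exact: linearZ. Qed.

Lemma br0r (g : lieAlg K) (x : g) : br x 0 = 0.
Proof. exact: linear0. Qed.

Lemma sum_brr (g : lieAlg K) I (s : seq I) (P : pred I) (F : I -> g) z :
  br z (\sum_(i <- s | P i) F i) = \sum_(i <- s | P i) br z (F i).
Proof. exact: linear_sum. Qed.

Lemma brDl (g : lieAlg K) (x y z : g) : br (x + y) z = br x z + br y z.
Proof. by rewrite -[x in LHS]scale1r br_linl scale1r. Qed.

Lemma br0l (g : lieAlg K) (z : g) : br 0 z = 0.
Proof. by apply: (addIr (br 0 z)); rewrite -brDl !add0r. Qed.

Lemma brZl (g : lieAlg K) a (x z : g) : br (a *: x) z = a *: br x z.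
Proof. by rewrite -[a *: x]addr0 br_linl br0l addr0. Qed.

Lemma br_anti (g : lieAlg K) (x y : g) : br x y = - br y x.
Proof.
apply/eqP; rewrite -addr_eq0; apply/eqP.
by have := br_alt (x + y); rewrite brDl !brDr !br_alt add0r addr0 addrC.
Qed.

Lemma brNl (g : lieAlg K) (x y : g) : br (- x) y = - br x y.
Proof. by rewrite -scaleN1r brZl scaleN1r. Qed.

Lemma br_leibniz (g : lieAlg K) (x y z : g) :
  br x (br y z) = br (br x y) z + br y (br x z).
Proof.
have := br_jacobi x y z; rewrite [br z x]br_anti brNr [br z _]br_anti.
by move/eqP; rewrite -addrA -opprD subr_eq0 => /eqP->; rewrite addrC.
Qed.

Lemma sum_brl (g : lieAlg K) I (s : seq I) (P : pred I) (F : I -> g) z :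
  br (\sum_(i <- s | P i) F i) z = \sum_(i <- s | P i) br (F i) z.
Proof. exact: (big_morph (fun x => br x z) (fun x y => brDl x y z) (br0l z)). Qed.

Lemma linear_id (V : lmodType K) : linear (fun v : V => v).
Proof. by []. Qed.

Lemma linear_comp (V W U : lmodType K) (f : W -> U) (g : V -> W) :
  linear f -> linear g -> linear (fun v => f (g v)).
Proof. by move=> fl gl a x y; rewrite gl fl. Qed.

Lemma linear_scalel (V U : lmodType K) (f : V -> K^o) (u : U) :
  linear f -> linear (fun v => f v *: u).
Proof. by move=> fl a x y; rewrite fl scalerDl scalerA. Qed.

Lemma linear_scaler (V U : lmodType K) (f : V -> U) c :
  linear f -> linear (fun v => c *: f v).
Proof. by move=> fl a x y; rewrite fl scalerDr !scalerA mulrC. Qed.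

Lemma linear_add (V U : lmodType K) (f g : V -> U) :
  linear f -> linear g -> linear (fun v => f v + g v).
Proof. by move=> fl gl a x y; rewrite fl gl scalerDr addrACA. Qed.

Lemma linear_sub (V U : lmodType K) (f g : V -> U) :
  linear f -> linear g -> linear (fun v => f v - g v).
Proof. by move=> fl gl a x y; rewrite fl gl scalerBr opprD addrACA. Qed.

Lemma bilin_comp (V W V' W' U : lmodType K) (b : V -> W -> U)
    (f : V' -> V) (g : W' -> W) :
  bilin b -> linear f -> linear g -> bilin (fun v w => b (f v) (g w)).
Proof. by case=> bl br fl gl; split=> ? a x y; rewrite /= ?fl ?gl ?bl ?br. Qed.

Lemma linear_bilin (V W U U' : lmodType K) (F : U -> U') (b : V -> W -> U) :
  linear F -> bilin b -> bilin (fun v w => F (b v w)).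
Proof. by move=> Fl [bl br]; split=> ? a x y; rewrite /= ?bl ?br Fl. Qed.

Lemma bilin_swap (V W U : lmodType K) (b : V -> W -> U) :
  bilin b -> bilin (fun w v => b v w).
Proof. by case=> bl br; split. Qed.

Lemma bilin_scale (V W U : lmodType K) (f : V -> K^o) (g : W -> U) :
  linear f -> linear g -> bilin (fun v w => f v *: g w).
Proof.
by move=> fl gl; split=> ?; [exact: linear_scalel | exact: linear_scaler].
Qed.

Lemma bilin_br (g : lieAlg K) : bilin (@br K g).
Proof. by split; [exact: br_linl | exact: br_linr]. Qed.

Lemma linear0f (V U : lmodType K) (f : V -> U) : linear f -> f 0 = 0.
Proof. by move=> fl; have := fl (-1) 0 0; rewrite scaler0 addr0 scaleN1r addNr. Qed.

Lemma linearZf (V U : lmodType K) (f : V -> U) c x :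
  linear f -> f (c *: x) = c *: f x.
Proof. by move=> fl; rewrite -[c *: x]addr0 fl linear0f ?addr0. Qed.

Lemma linearDf (V U : lmodType K) (f : V -> U) x y :
  linear f -> f (x + y) = f x + f y.
Proof. by move=> fl; rewrite -[x in LHS]scale1r fl scale1r. Qed.

Lemma linearNf (V U : lmodType K) (f : V -> U) x : linear f -> f (- x) = - f x.
Proof. by move=> fl; rewrite -scaleN1r linearZf // scaleN1r. Qed.

Lemma linear_sumf (V U : lmodType K) (f : V -> U) I (s : seq I) (P : pred I)
    (F : I -> V) :
  linear f -> f (\sum_(i <- s | P i) F i) = \sum_(i <- s | P i) f (F i).
Proof. by move=> fl; apply: (big_morph f _ (linear0f fl)) => x y; exact: linearDf. Qed.

Lemma pureZl (V W : vectType K) c (v : V) (w : W) : pure (c *: v) w = c *: pure v w.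
Proof. exact: (linearZf _ _ ((bilin_pure V W).1 w)). Qed.

Lemma pureZr (V W : vectType K) c (v : V) (w : W) : pure v (c *: w) = c *: pure v w.
Proof. exact: (linearZf _ _ ((bilin_pure V W).2 v)). Qed.

Lemma pureDl (V W : vectType K) (v v' : V) (w : W) :
  pure (v + v') w = pure v w + pure v' w.
Proof. exact: (linearDf _ _ ((bilin_pure V W).1 w)). Qed.

Lemma pureDr (V W : vectType K) (v : V) (w w' : W) :
  pure v (w + w') = pure v w + pure v w'.
Proof. exact: (linearDf _ _ ((bilin_pure V W).2 v)). Qed.

Lemma pureNl (V W : vectType K) (v : V) (w : W) : pure (- v) w = - pure v w.
Proof. exact: (linearNf _ ((bilin_pure V W).1 w)). Qed.

Lemma pureNr (V W : vectType K) (v : V) (w : W) : pure v (- w) = - pure v w.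
Proof. exact: (linearNf _ ((bilin_pure V W).2 v)). Qed.

Lemma pure0l (V W : vectType K) (w : W) : pure (0 : V) w = 0.
Proof. exact: (linear0f ((bilin_pure V W).1 w)). Qed.

Lemma pure0r (V W : vectType K) (v : V) : pure v (0 : W) = 0.
Proof. exact: (linear0f ((bilin_pure V W).2 v)). Qed.

Lemma ecoord_lincomb (V : vectType K) (c : 'I_(\dim {:V}%VS) -> K) k :
  ecoord k (\sum_m c m *: ebase m : V) = c k.
Proof.
rewrite (linear_sumf _ _ _ (ecoord_linear k)) (bigD1 k) //= big1 => [|m /negbTE nm].
  by rewrite addr0 (linearZf _ _ (ecoord_linear k)) ecoord_ebase eqxx; exact: mulr1.
by rewrite (linearZf _ _ (ecoord_linear k)) ecoord_ebase eq_sym nm; exact: mulr0.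
Qed.

Lemma bilin_add (V W U : lmodType K) (b b' : V -> W -> U) :
  bilin b -> bilin b' -> bilin (fun v w => b v w + b' v w).
Proof.
by case=> bl br [bl' br']; split=> ?; exact: linear_add.
Qed.

Lemma bilin_ad (g : lieAlg K) (x : g) :
  bilin (fun a b : g => pure (br x a) b + pure a (br x b)).
Proof.
by apply: bilin_add; apply: bilin_comp (bilin_pure _ _) _ _ => //; exact: br_linr.
Qed.

Lemma ad2_pure (g : lieAlg K) (x a b : g) :
  ad2 x (pure a b) = pure (br x a) b + pure a (br x b).
Proof. exact: tliftP (bilin_ad x). Qed.

Lemma tmap_pure (V W V' W' : vectType K) (f : V -> V') (h : W -> W') v w :
  linear f -> linear h -> tmap f h (pure v w) = pure (f v) (h w).
Proof. by move=> fl hl; rewrite /tmap tliftP //; exact: (bilin_comp (bilin_pure _ _) fl hl). Qed.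

Lemma flip_pure (V : vectType K) (v w : V) : flip (pure v w) = pure w v.
Proof. exact: tliftP (bilin_swap (bilin_pure V V)). Qed.

Lemma flipK (V : vectType K) (t : tens V V) : flip (flip t) = t.
Proof.
rewrite {1}/flip tlift_flip ?tlift_id //; exact: bilin_swap (bilin_pure V V).
Qed.

Lemma tmap_flip (V W : vectType K) (f : V -> W) t :
  linear f -> tmap f f (flip t) = flip (tmap f f t).
Proof.
move=> fl; rewrite [LHS]tlift_flip; last exact: (bilin_comp (bilin_pure _ _) fl fl).
rewrite [in RHS]/tmap (linear_tlift _ _ (@flip_linear W)).
by apply: eq_tlift => v w; rewrite flip_pure.
Qed.

Lemma tmap_ad2 (g g' : lieAlg K) (f : g -> g') x t :
  linear f -> (forall y z, f (br y z) = br (f y) (f z)) ->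
  tmap f f (ad2 x t) = ad2 (f x) (tmap f f t).
Proof.
move=> fl fM; rewrite [LHS]tlift_ad2; last exact: (bilin_comp (bilin_pure _ _) fl fl).
rewrite [in RHS]/tmap (linear_tlift _ _ (@ad2_linear g' (f x))).
by apply: eq_tlift => v w; rewrite ad2_pure !fM.
Qed.

Lemma flip_ad2 (g : lieAlg K) (x : g) t : flip (ad2 x t) = ad2 x (flip t).
Proof.
rewrite [LHS]tlift_ad2; last exact: bilin_swap (bilin_pure _ _).
rewrite [in RHS]/flip (linear_tlift _ _ (@ad2_linear g x)).
by apply: eq_tlift => v w; rewrite ad2_pure addrC.
Qed.

Lemma ad2Dl (g : lieAlg K) (x y : g) t : ad2 (x + y) t = ad2 x t + ad2 y t.
Proof.
rewrite /ad2 -tlift_add; apply: eq_tlift => a b.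
by rewrite !brDl pureDl pureDr addrACA.
Qed.

Lemma ad2Zl (g : lieAlg K) c (x : g) t : ad2 (c *: x) t = c *: ad2 x t.
Proof.
rewrite /ad2 -tlift_scale; apply: eq_tlift => a b.
by rewrite !brZl pureZl pureZr scalerDr.
Qed.

Lemma ad2_linl (g : lieAlg K) t : linear (fun x : g => ad2 x t).
Proof. by move=> a x y; rewrite ad2Dl ad2Zl. Qed.

Lemma bilin_wedge (V : vectType K) : bilin (@wedge K V).
Proof.
by split=> u; apply: linear_sub; first [exact: (bilin_pure V V).1 | exact: (bilin_pure V V).2].
Qed.

Lemma ad2_wedge (g : lieAlg K) (x u v : g) :
  ad2 x (wedge u v) = wedge (br x u) v + wedge u (br x v).
Proof.
rewrite /wedge (linearDf _ _ (@ad2_linear g x)) (linearNf _ (@ad2_linear g x)) !ad2_pure.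
by rewrite [pure (br x v) u + _]addrC opprD addrACA.
Qed.

Lemma wedgeNl (V : vectType K) (u v : V) : wedge (- u) v = - wedge u v.
Proof. exact: linearNf ((bilin_wedge V).1 v). Qed.

Lemma tlift_coord (V W : vectType K) i j (t : tens V W) :
  @tlift K V W K^o (fun v w => ecoord i v * ecoord j w) t = (t : 'M_(_, _)) i j.
Proof.
rewrite -[in RHS](tlift_id t).
rewrite (linear_tlift (F := fun s : tens V W => (s : 'M_(_, _)) i j : K^o)) => [|a x y].
  by apply: eq_tlift => v w; rewrite mxE.
by rewrite !mxE.
Qed.

End Tensors.

(** * Coordinate vectors *)

Section Vec.
Variables (K : fieldType) (V : vectType K).
Local Notation n := (\dim {:V}%VS).

Lemma dual_of_linear (f : V -> K^o) :
  linear f -> exists phi : dual V, forall v, phi v = f v.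
Proof.
move=> fl; pose F : {linear V -> K^o} :=
  HB.pack f (GRing.isLinear.Build K V K^o _ f fl).
by exists (linfun F) => v; rewrite lfunE.
Qed.

Definition rowof (x : V) : 'rV[K]_n := \row_k ecoord k x.
Definition vecof (u : 'rV[K]_n) : V := \sum_k u 0 k *: ebase k.

Lemma rowof_linear : linear rowof.
Proof. by move=> c x y; apply/rowP => k; rewrite !mxE ecoord_linear. Qed.

Lemma vecof_linear : linear vecof.
Proof.
move=> c u v; rewrite /vecof scaler_sumr -big_split; apply: eq_bigr => k _.
by rewrite !mxE scalerDl scalerA.
Qed.

Lemma rowofK : cancel rowof vecof.
Proof. by move=> x; rewrite [RHS]ebase_sum; apply: eq_bigr => k _; rewrite mxE. Qed.

Lemma vecofK : cancel vecof rowof.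
Proof. by move=> u; apply/rowP => k; rewrite mxE ecoord_lincomb. Qed.

End Vec.

(** * The co-Jacobi identity under trilinear maps *)

Section CoJacobi.
Variables (K : fieldType) (V U : vectType K).

Definition trilin (f : V -> V -> V -> U) : Prop :=
  (forall u, bilin (f u)) /\ forall v w, linear (fun u => f u v w).

Lemma trilin_lift (f : V -> V -> V -> U) :
  trilin f -> bilin (fun u (s : tens V V) => tlift (f u) s).
Proof.
case=> fb fl; split=> [s a u u'|u]; last exact: tlift_linear.
rewrite /= -tlift_scale -tlift_add.
by apply: eq_tlift => v w; rewrite fl.
Qed.

Lemma tlift_cyc3 (f : V -> V -> V -> U) (t : tens V (tens V V)) :
  trilin f ->
  tlift (fun u s => tlift (f u) s) (cyc3 t)
  = tlift (fun u s => tlift (fun v w => f v w u) s) t.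
Proof.
move=> ft; have fb := trilin_lift ft; rewrite /cyc3 (linear_tlift _ _ (@tlift_linear _ _ _ _ _)).
apply: eq_tlift => u s; rewrite (linear_tlift _ _ (@tlift_linear _ _ _ _ _)).
apply: eq_tlift => v w; rewrite (tliftP _ _ fb) tliftP //; exact: ft.1.
Qed.

Lemma trilin_rot (f : V -> V -> V -> U) :
  trilin f -> trilin (fun u v w => f v w u).
Proof.
move=> [fb fl]; split=> [u|v w].
  by split=> [w|v]; [exact: fl | exact: (fb v).1].
exact: (fb v).2.
Qed.

Lemma tlift_tri (delta : V -> tens V V) (f : V -> V -> V -> U) t : trilin f ->
  tlift (fun u s => tlift (f u) s) (tlift (fun a b => pure a (delta b)) t)
  = tlift (fun a b => tlift (f a) (delta b)) t.
Proof.
move=> ft; rewrite (linear_tlift _ _ (@tlift_linear _ _ _ _ _)).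
by apply: eq_tlift => a b; rewrite (tliftP _ _ (trilin_lift ft)).
Qed.

(** Contracting the three factors by a trilinear map is how the components of
    the co-Jacobi identity are read off; the cyclic permutations move to the
    arguments of the map. *)
Lemma coJacobi_trilin (delta : V -> tens V V) (f : V -> V -> V -> U) (x : V) :
  lie_coalgebra delta -> trilin f ->
  tlift (fun a b => tlift (f a) (delta b)) (delta x)
  + tlift (fun a b => tlift (fun v w => f v w a) (delta b)) (delta x)
  + tlift (fun a b => tlift (fun v w => f w a v) (delta b)) (delta x) = 0.
Proof.
case=> _ _ /(_ x) cJ ft.
have ft1 := trilin_rot ft; have ft2 := trilin_rot ft1.
rewrite -(tlift_tri _ _ ft) -(tlift_tri _ _ ft1) -(tlift_tri _ _ ft2) -(tlift_cyc3 _ ft).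
rewrite -(tlift_cyc3 _ ft1) -(tlift_cyc3 _ ft).
by rewrite -!linearD cJ linear0.
Qed.

End CoJacobi.

(** * Tensors over the product with an abelian algebra *)

Section Product.
Variables (K : fieldType) (g : lieAlg K) (d : nat).
Let V := kvec K d.
Let L := lie_prod_abelian g V.

Definition prV (a : L) : V := a.2.

Lemma inG_linear : linear (@inG K g V).
Proof. by move=> a x y; congr pair; rewrite /= ?scaler0 ?addr0. Qed.
Lemma inV_linear : linear (@inV K g V).
Proof. by move=> a x y; congr pair; rewrite /= ?scaler0 ?addr0. Qed.
Lemma prG_linear : linear (@prG K g V).
Proof. by []. Qed.
Lemma prV_linear : linear prV.
Proof. by []. Qed.

Definition crd (j : 'I_d) (v : V) : K := (v : 'rV_d) 0 j.
Definition bas (j : 'I_d) : V := delta_mx 0 j.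

Lemma crd_linear j : linear (crd j : V -> K^o).
Proof. by move=> a x y; rewrite /crd !mxE. Qed.

Lemma crd_bas i j : crd i (bas j) = (i == j)%:R.
Proof. by rewrite /crd mxE eqxx. Qed.

Lemma sum_bas (v : V) : v = \sum_j crd j v *: bas j.
Proof. exact: row_sum_delta. Qed.

Lemma crd_prV_linear j : linear (fun a : L => crd j (prV a) : K^o).
Proof. exact: linear_comp (crd_linear j) prV_linear. Qed.

(** The coefficient of the j-th basis vector of V in the g (x) V component. *)
Definition gcomp (j : 'I_d) (t : tens L L) : g :=
  tlift (fun a b => crd j (prV b) *: prG a) t.

Lemma bilin_gcomp j : bilin (fun a b : L => crd j (prV b) *: prG a).
Proof.
apply: bilin_swap; apply: bilin_scale; [exact: crd_prV_linear | exact: prG_linear].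
Qed.

Lemma gcomp_linear j : linear (gcomp j).
Proof. exact: tlift_linear. Qed.

Lemma inGV (a : L) : a = inG V (prG a) + inV g (prV a).
Proof. by case: a => x v; congr pair; rewrite /= ?addr0 ?add0r. Qed.

(** The V (x) g component is written through the flip, so that an antisymmetric
    tensor is determined by its g (x) g, g (x) V and V (x) V components. *)
Lemma tens_split (t : tens L L) :
  t = tmap (@inG K g V) (@inG K g V) (tmap (@prG K g V) (@prG K g V) t)
      + \sum_j pure (inG V (gcomp j t)) (inV g (bas j))
      + \sum_j pure (inV g (bas j)) (inG V (gcomp j (flip t)))
      + tmap (@inV K g V) (@inV K g V) (tmap prV prV t).
Proof.
have bP (W W' : vectType K) := bilin_pure W W'.
have e1 : tmap (@inG K g V) (@inG K g V) (tmap (@prG K g V) (@prG K g V) t)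
    = tlift (fun a b => pure (inG V (prG a)) (inG V (prG b))) t.
  by rewrite {1}/tmap tlift_tmap //; apply: bilin_comp inG_linear inG_linear.
have e4 : tmap (@inV K g V) (@inV K g V) (tmap prV prV t)
    = tlift (fun a b => pure (inV g (prV a)) (inV g (prV b))) t.
  by rewrite {1}/tmap tlift_tmap //; apply: bilin_comp inV_linear inV_linear.
have e2 : \sum_j pure (inG V (gcomp j t)) (inV g (bas j))
    = tlift (fun a b => pure (inG V (prG a)) (inV g (prV b))) t.
  transitivity (tlift (fun a b => \sum_j
      pure (inG V (crd j (prV b) *: prG a)) (inV g (bas j))) t).
    rewrite tlift_sum; apply: eq_bigr => j _.
    rewrite /gcomp (linear_tlift _ _ inG_linear).
    by rewrite (linear_tlift _ _ ((bP L L).1 _)).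
  apply: eq_tlift => a b; rewrite {2}[prV b]sum_bas.
  rewrite (linear_sumf _ _ _ inV_linear) (linear_sumf _ _ _ ((bP L L).2 _)).
  apply: eq_bigr => j _.
  by rewrite (linearZf _ _ inG_linear) (linearZf _ _ inV_linear) pureZl pureZr.
have e3 : \sum_j pure (inV g (bas j)) (inG V (gcomp j (flip t)))
    = tlift (fun a b => pure (inV g (prV a)) (inG V (prG b))) t.
  transitivity (tlift (fun a b => \sum_j
      pure (inV g (bas j)) (inG V (crd j (prV a) *: prG b))) t).
    rewrite tlift_sum; apply: eq_bigr => j _.
    rewrite /gcomp (tlift_flip _ (bilin_gcomp j)) (linear_tlift _ _ inG_linear).
    by rewrite (linear_tlift _ _ ((bP L L).2 _)).
  apply: eq_tlift => a b; rewrite {2}[prV a]sum_bas.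
  rewrite (linear_sumf _ _ _ inV_linear) (linear_sumf _ _ _ ((bP L L).1 _)).
  apply: eq_bigr => j _.
  by rewrite (linearZf _ _ inG_linear) (linearZf _ _ inV_linear) pureZl pureZr.
rewrite e1 e2 e3 e4 -!tlift_add -{1}[t]tlift_id; apply: eq_tlift => a b.
rewrite {1}[a]inGV {1}[b]inGV.
by rewrite pureDl !pureDr !addrA.
Qed.

End Product.

(** * Bialgebra structures on the product with an abelian algebra *)

Section Structure.
Variables (K : fieldType) (g : lieAlg K) (d : nat).
Local Notation V := (kvec K d).
Local Notation L := (lie_prod_abelian g V).
Variable (delta : L -> tens L L).
Hypothesis bialg : lie_bialgebra delta.
Hypothesis centreless : forall z : g, (forall x, br x z = 0) -> z = 0.
Hypothesis perfect : forall l : g -> K^o, linear l ->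
  (forall x y, l (br x y) = 0) -> forall x, l x = 0.
Hypothesis noinv : forall t : tens g g,
  flip t = - t -> (forall x, ad2 x t = 0) -> t = 0.
Hypothesis inner : forall D : g -> g, linear D ->
  (forall x y, D (br x y) = br (D x) y + br x (D y)) ->
  exists z, forall x, D x = br z x.
Hypothesis zeros_comm : forall x y : g,
  delta_g delta x = 0 -> delta_g delta y = 0 -> br x y = 0.

Let dlin : linear delta. Proof. by case: bialg => -[]. Qed.
Let danti (a : L) : flip (delta a) = - delta a. Proof. by case: bialg => -[_ /(_ a)]. Qed.
Let cocycle := bialg.2.
Local Notation iG := (@inG K g V).
Local Notation iV := (@inV K g V).
Local Notation pG := (@prG K g V).
Local Notation pV := (@prV K g d).
Let iGl : linear iG. Proof. exact: inG_linear. Qed.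
Let iVl : linear iV. Proof. exact: inV_linear. Qed.
Let pGl : linear pG. Proof. exact: prG_linear. Qed.
Let pVl : linear pV. Proof. exact: prV_linear. Qed.

Let br_iG x y : br (iG x) (iG y) = iG (br x y). Proof. by []. Qed.
Let br_iV v (a : L) : br (iV v) a = 0.
Proof. by congr pair; rewrite /= br0l. Qed.
Let br_iVr v (a : L) : br a (iV v) = 0.
Proof. by congr pair; rewrite /= br0r. Qed.
Let pG_br (a b : L) : pG (br a b) = br (pG a) (pG b). Proof. by []. Qed.
Let pV_br (a b : L) : pV (br a b) = 0. Proof. by []. Qed.
Let pGiG x : pG (iG x) = x. Proof. by []. Qed.
Let pViG x : pV (iG x) = 0. Proof. by []. Qed.
Let pGiV v : pG (iV v) = 0. Proof. by []. Qed.

Let gcomp_ad (x : L) t j : gcomp j (ad2 x t) = br (pG x) (gcomp j t).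
Proof.
rewrite /gcomp tlift_ad2; last exact: bilin_gcomp.
rewrite (linear_tlift _ _ (br_linr _)); apply: eq_tlift => a b.
by rewrite pV_br pG_br /crd mxE scale0r addr0 brZr.
Qed.

Let ad2_iV v (t : tens L L) : ad2 (iV v) t = 0.
Proof.
rewrite /ad2 -[RHS](tlift0 _ t); apply: eq_tlift => a b.
by rewrite !br_iV pure0l pure0r addr0.
Qed.

Let ad_delta_iV x v : ad2 x (delta (iV v)) = 0.
Proof.
have := cocycle x (iV v); rewrite br_iVr ad2_iV subr0 => <-; exact: linear0f.
Qed.

Definition deltaV (v : V) : tens V V := tmap pV pV (delta (iV v)).

Let tmapVV_ad x t : tmap pV pV (ad2 x t) = 0.
Proof.
rewrite [LHS]tlift_ad2; last exact: (bilin_comp (bilin_pure _ _) pVl pVl).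
by rewrite -[RHS](tlift0 _ t); apply: eq_tlift => a b; rewrite !pV_br pure0l pure0r addr0.
Qed.

(** The vectors of V are central, so the cocycle condition makes delta(v)
    invariant under g; its components in g (x) V and g (x) g then vanish. *)
Lemma delta_iV v : delta (iV v) = tmap iV iV (deltaV v).
Proof.
have gc0 j : gcomp j (delta (iV v)) = 0.
  apply: centreless => x.
  by rewrite -[x]pGiG -gcomp_ad ad_delta_iV (linear0f (gcomp_linear (d := d) j)).
have gg0 : tmap pG pG (delta (iV v)) = 0.
  apply: noinv => [|x].
    by rewrite -(tmap_flip _ pGl) danti linearN.
  by rewrite -{1}[x]pGiG -(tmap_ad2 _ _ pGl pG_br) ad_delta_iV linear0.
rewrite [LHS]tens_split gg0 linear0 add0r danti.
rewrite big1 ?add0r => [|j _]; last by rewrite gc0 (linear0f iGl) pure0l.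
rewrite big1 ?add0r // => j _.
by rewrite (linearNf _ (gcomp_linear (d := d) j)) gc0 oppr0 (linear0f iGl) pure0r.
Qed.

Let dgE x : tmap pG pG (delta (iG x)) = delta_g delta x. Proof. by []. Qed.

Let dg_lin : linear (delta_g delta).
Proof. by move=> a x y; rewrite /delta_g iGl dlin linearP. Qed.

Lemma delta_g_anti x : flip (delta_g delta x) = - delta_g delta x.
Proof. by rewrite -dgE -(tmap_flip _ pGl) danti linearN. Qed.

Let dg_cocycle x y : delta_g delta (br x y)
  = ad2 x (delta_g delta y) - ad2 y (delta_g delta x).
Proof.
rewrite -[LHS]dgE -br_iG cocycle linearB /=.
by rewrite !(tmap_ad2 _ _ pGl pG_br) !pGiG.
Qed.

(** The coordinates of the g (x) V component inherit the cocycle condition, and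
    a cocycle with values in g is a derivation. *)
Lemma delta_derivations : exists Z : 'I_d -> g,
  forall j x, gcomp j (delta (iG x)) = br (Z j) x.
Proof.
suff h j : exists z, forall x, gcomp j (delta (iG x)) = br z x.
  have /choice [Z ZE] := h; by exists Z.
apply: inner => [a x y|x y].
  by rewrite iGl dlin (gcomp_linear (d := d) j).
rewrite -br_iG cocycle (linearDf _ _ (gcomp_linear (d := d) j)).
rewrite (linearNf _ (gcomp_linear (d := d) j)) !gcomp_ad !pGiG addrC.
by congr (_ + _); rewrite [RHS]br_anti.
Qed.

Let deltaVV0 x : tmap pV pV (delta (iG x)) = 0.
Proof.
apply/matrixP => i k; rewrite [RHS]mxE.
pose l (y : g) : K^o := (tmap pV pV (delta (iG y)) : 'M_(_, _)) i k.
apply: (perfect (l := l)) => [a y z|y z]; rewrite /l.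
  by rewrite iGl dlin linearP /= !mxE.
by rewrite -br_iG cocycle linearB /= !tmapVV_ad subr0 mxE.
Qed.

Let tlift_delta_iV (U : lmodType K) (b : L -> L -> U) v : bilin b ->
  tlift b (delta (iV v)) = tlift (fun y z => b (iV y) (iV z)) (deltaV v).
Proof. by move=> bb; rewrite delta_iV tlift_tmap. Qed.

Section Components.
Variable Z : 'I_d -> g.
Hypothesis ZE : forall j x, gcomp j (delta (iG x)) = br (Z j) x.

Lemma delta_iG x : delta (iG x) = tmap iG iG (delta_g delta x)
  + \sum_j wedge (iG (br (Z j) x)) (iV (@bas K d j)).
Proof.
rewrite [LHS]tens_split deltaVV0 linear0 addr0 danti -addrA.
congr (_ + _); rewrite -big_split; apply: eq_bigr => j _ /=.
by rewrite (linearNf _ (gcomp_linear (d := d) j)) ZE /wedge (linearNf _ iGl) pureNr.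
Qed.

Let tlift_delta_iG (U : lmodType K) (b : L -> L -> U) x : bilin b ->
  tlift b (delta (iG x)) = tlift (fun y z => b (iG y) (iG z)) (delta_g delta x)
   + \sum_j (b (iG (br (Z j) x)) (iV (@bas K d j)) - b (iV (@bas K d j)) (iG (br (Z j) x))).
Proof.
move=> bb; rewrite delta_iG linearD /= tlift_tmap // (linear_sumf _ _ _ (tlift_linear b)).
congr (_ + _).
by apply: eq_bigr => j _; rewrite linearB /= !tliftP.
Qed.

Let sum_crd (U : lmodType K) (F : 'I_d -> U) j :
  \sum_k crd j (@bas K d k) *: F k = F j.
Proof.
rewrite (bigD1 j) //= crd_bas eqxx scale1r big1 ?addr0 // => k /negbTE nk.
by rewrite crd_bas eq_sym nk scale0r.
Qed.

Let crd0 j : crd j (0 : V) = 0. Proof. by rewrite /crd mxE. Qed.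

Let tlift_eq0 (W1 W2 : vectType K) (U : lmodType K) (b : W1 -> W2 -> U) t :
  (forall v w, b v w = 0) -> tlift b t = 0.
Proof. by move=> b0; rewrite -[RHS](tlift0 U t); exact: eq_tlift. Qed.

(** This is the V (x) g (x) g component of the co-Jacobi identity. *)
Lemma delta_coderivation j x :
  delta_g delta (br (Z j) x) = ad2 (Z j) (delta_g delta x).
Proof.
pose f (u v w : L) : tens g g := crd j (pV u) *: pure (pG v) (pG w).
have cl : linear (fun u : L => crd j (pV u) : K^o) by exact: crd_prV_linear.
have pb : bilin (fun v w : L => pure (pG v) (pG w)).
  exact: (bilin_comp (bilin_pure _ _) pGl pGl).
have ft : trilin f.
  split=> [u|v w]; last exact: linear_scalel.
  exact: (linear_bilin (linear_scaler _ (@linear_id _ _)) pb).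
have ft1 := trilin_rot ft; have ft2 := trilin_rot ft1.
have db h (ht : trilin h) := bilin_comp (trilin_lift ht) (@linear_id K L) dlin.
have J1 : tlift (fun a b => tlift (f a) (delta b)) (delta (iG x))
    = - delta_g delta (br (Z j) x).
  rewrite (tlift_delta_iG _ (db _ _ ft)) tlift_eq0 => [|y z]; last first.
    by apply: tlift_eq0 => v w; rewrite /f pViG crd0 scale0r.
  rewrite add0r -(sum_crd (fun k => delta_g delta (br (Z k) x))) -sumrN.
  apply: eq_bigr => k _; rewrite tlift_eq0 => [|v w]; last first.
    by rewrite /f pViG crd0 scale0r.
  by rewrite sub0r tlift_scale.
have J2 : tlift (fun a b => tlift (fun v w => f v w a) (delta b)) (delta (iG x))
    = tlift (fun y z => - pure (br (Z j) z) y) (delta_g delta x).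
  rewrite (tlift_delta_iG _ (db _ _ ft1)) big1 ?addr0 => [|k _]; last first.
    rewrite (tlift_delta_iV _ (ft1.1 _)) !tlift_eq0 ?subr0 // => v w.
      by rewrite /f pGiV pure0r scaler0.
    by rewrite /f !pGiV pure0l scaler0.
  apply: eq_tlift => y z; rewrite -pureNl -ZE -(linearNf _ (gcomp_linear (d := d) j)) -danti.
  rewrite /gcomp tlift_flip; last exact: bilin_gcomp.
  rewrite (linear_tlift _ _ ((bilin_pure g g).1 y)); apply: eq_tlift => v w.
  by rewrite /f pureZl.
have J3 : tlift (fun a b => tlift (fun v w => f w a v) (delta b)) (delta (iG x))
    = tlift (fun y z => pure y (br (Z j) z)) (delta_g delta x).
  rewrite (tlift_delta_iG _ (db _ _ ft2)) big1 ?addr0 => [|k _]; last first.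
    rewrite (tlift_delta_iV _ (ft2.1 _)) !tlift_eq0 ?subr0 // => v w.
      by rewrite /f pGiV pure0l scaler0.
    by rewrite /f !pGiV pure0r scaler0.
  apply: eq_tlift => y z; rewrite -ZE.
  rewrite /gcomp (linear_tlift _ _ ((bilin_pure g g).2 y)); apply: eq_tlift => v w.
  by rewrite /f pureZr.
have := coJacobi_trilin (iG x) bialg.1 ft; rewrite J1 J2 J3 -addrA addrC => /eqP.
rewrite subr_eq0 => /eqP <-; rewrite /ad2 tlift_add; congr (_ + _).
have b1 : bilin (fun y z : g => pure (br (Z j) y) z).
  exact: (bilin_comp (bilin_pure g g) (br_linr _) (@linear_id _ _)).
by rewrite tlift_opp -(tlift_flip _ b1) delta_g_anti linearN opprK.
Qed.

(** By the cocycle condition the coderivation property says that delta_g(Z_j) is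
    invariant. *)
Lemma delta_g_Z j : delta_g delta (Z j) = 0.
Proof.
apply: noinv => [|x]; first exact: delta_g_anti.
have := delta_coderivation j x; rewrite dg_cocycle => /eqP.
by rewrite -subr_eq0 addrAC subrr sub0r oppr_eq0 => /eqP.
Qed.

(** This is the g (x) V (x) V component of the co-Jacobi identity. Its two
    quadratic terms cancel because the Z_j, being zeros of delta_g, commute. *)
Lemma deltaV_Z (l : V -> V -> K^o) :
  bilin l -> \sum_j tlift l (deltaV (@bas K d j)) *: Z j = 0.
Proof.
move=> lb; apply: centreless => x; rewrite br_anti sum_brl.
pose f (u v w : L) : g := l (pV v) (pV w) *: pG u.
have ft : trilin f.
  split=> [u|v w]; last exact: linear_scaler pGl.
  split=> [w|v].
    exact: (linear_scalel _ (linear_comp (lb.1 _) pVl)).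
  exact: (linear_scalel _ (linear_comp (lb.2 _) pVl)).
have ft1 := trilin_rot ft; have ft2 := trilin_rot ft1.
have db h (ht : trilin h) := bilin_comp (trilin_lift ht) (@linear_id K L) dlin.
have l0r u : l u 0 = 0 by exact: linear0f (lb.2 u).
have l0l u : l 0 u = 0 by exact: linear0f (lb.1 u).
have J1 : tlift (fun a b => tlift (f a) (delta b)) (delta (iG x))
    = \sum_j br (tlift l (deltaV (@bas K d j)) *: Z j) x.
  rewrite (tlift_delta_iG _ (db _ _ ft)) tlift_eq0 => [|y z]; last first.
    rewrite (tlift_delta_iG _ (ft.1 _)) tlift_eq0 => [|v w].
      rewrite big1 ?addr0 // => k _.
      by rewrite /f !pViG l0l l0r !scale0r subr0.
    by rewrite /f pViG l0l scale0r.
  rewrite add0r; apply: eq_bigr => k _; rewrite (tlift_delta_iV _ (ft.1 _)) brZl.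
  rewrite (tlift_eq0 (b := f _)) ?subr0 => [|v w]; last by rewrite /f pGiV scaler0.
  exact: esym (linear_tlift l _ (linear_scalel (br (Z k) x) (@linear_id K K^o))).
have Zcomm k m : br (Z k) (br (Z m) x) = br (Z m) (br (Z k) x).
  by rewrite br_leibniz (zeros_comm (delta_g_Z k) (delta_g_Z m)) br0l add0r.
have J2 : tlift (fun a b => tlift (fun v w => f v w a) (delta b)) (delta (iG x))
    = - \sum_k \sum_m l (@bas K d m) (@bas K d k) *: br (Z m) (br (Z k) x).
  rewrite (tlift_delta_iG _ (db _ _ ft1)) tlift_eq0 => [|y z]; last first.
    by apply: tlift_eq0 => v w; rewrite /f pViG l0r scale0r.
  rewrite add0r -sumrN; apply: eq_bigr => k _.
  rewrite tlift_eq0 => [|v w]; last by rewrite /f pViG l0r scale0r.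
  rewrite sub0r (tlift_delta_iG _ (ft1.1 _)) tlift_eq0 => [|v w]; last first.
    by rewrite /f pViG l0l scale0r.
  rewrite add0r; congr (- _); apply: eq_bigr => m _.
  by rewrite /f !pGiV !pGiG scaler0 subr0.
have J3 : tlift (fun a b => tlift (fun v w => f w a v) (delta b)) (delta (iG x))
    = \sum_k \sum_m l (@bas K d k) (@bas K d m) *: br (Z m) (br (Z k) x).
  rewrite (tlift_delta_iG _ (db _ _ ft2)) tlift_eq0 => [|y z]; last first.
    by apply: tlift_eq0 => v w; rewrite /f pViG l0l scale0r.
  rewrite add0r; apply: eq_bigr => k _.
  rewrite tlift_eq0 => [|v w]; last by rewrite /f pViG l0l scale0r.
  rewrite sub0r (tlift_delta_iG _ (ft2.1 _)) tlift_eq0 => [|v w]; last first.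
    by rewrite /f pViG l0r scale0r.
  rewrite add0r -sumrN; apply: eq_bigr => m _.
  by rewrite /f !pGiV !pGiG scaler0 sub0r opprK.
have := coJacobi_trilin (iG x) bialg.1 ft; rewrite J1 J2 J3 [in X in _ + X]exchange_big /=.
under [X in _ + _ + X]eq_bigr do under eq_bigr do rewrite Zcomm.
by rewrite addrNK => ->; rewrite oppr0.
Qed.

End Components.

Lemma deltaV_linear : linear deltaV.
Proof. by move=> a x y; rewrite /deltaV iVl dlin linearP. Qed.

Lemma deltaV_coalgebra : lie_coalgebra deltaV.
Proof.
split=> [|v|v t]; first exact: deltaV_linear.
  by rewrite /in_Lambda2 /deltaV -(tmap_flip _ pVl) danti linearN.
pose h (u v w : V) := pure u (pure v w).
have ht : trilin h.
  split=> [u|u' w]; last exact: (bilin_pure _ _).1.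
  exact: linear_bilin ((bilin_pure _ _).2 u) (bilin_pure _ _).
have pt k : trilin k -> trilin (fun u v w : L => k (pV u) (pV v) (pV w) : tens V (tens V V)).
  move=> kt; split=> [u|u' w]; last exact: linear_comp (kt.2 _ _) pVl.
  exact: (bilin_comp (kt.1 _) pVl pVl).
have ht1 := trilin_rot ht; have ht2 := trilin_rot ht1.
have hE (s : tens V (tens V V)) : s = tlift (fun u s' => tlift (h u) s') s.
  rewrite -[LHS]tlift_id; apply: eq_tlift => u s'.
  rewrite -[s' in LHS]tlift_id; exact: linear_tlift ((bilin_pure _ _).2 u).
have c1 s : cyc3 s = tlift (fun u s' => tlift (fun v w => h v w u) s') s.
  by rewrite -tlift_cyc3.
have c2 s : cyc3 (cyc3 s) = tlift (fun u s' => tlift (fun v w => h w u v) s') s.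
  by rewrite [LHS]c1 (tlift_cyc3 _ ht1).
have J (k : V -> V -> V -> tens V (tens V V)) (kt : trilin k) :
    tlift (fun a b => tlift (fun v w => k (pV a) (pV v) (pV w)) (delta b)) (delta (iV v))
    = tlift (fun u s => tlift (k u) s) t.
  have kb := bilin_comp (trilin_lift (pt _ kt)) (@linear_id K L) dlin.
  rewrite (tlift_delta_iV _ kb).
  rewrite (tlift_tri _ _ kt); apply: eq_tlift => y z.
  by rewrite (tlift_delta_iV _ ((pt _ kt).1 _)).
have := coJacobi_trilin (iV v) bialg.1 (pt _ ht).
by rewrite (J _ ht) (J _ ht1) (J _ ht2) -hE -c1 -c2.
Qed.

(** Let M be the matrix of the Z_j. In a factorization M = C (1 0; 0 0) R with
    C and R invertible, the columns of C give the basis of V and the first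
    rank(M) rows of R give the H_i; the relation sum_j Z_j (x) delta_V(e_j) = 0
    becomes sum_i H_i (x) delta_V(t_i) = 0. *)
Theorem product_structure :
  exists (t : d.-tuple V) (d0 : nat) (H : d0.-tuple g),
    [/\ [/\ basis_of {:V}%VS t, (d0 <= d)%N & free H],
        forall i : 'I_d0, delta_g delta H`_i = 0,
        forall x, delta (iG x) = tmap iG iG (delta_g delta x)
          + \sum_(i < d0) wedge (iG (br H`_i x)) (iV t`_i),
        forall v, delta (iV v) = tmap iV iV (deltaV v)
      & forall i : 'I_d0, deltaV t`_i = 0].
Proof.
have [Z ZE] := delta_derivations.
pose n := \dim {:g}%VS.
pose M : 'M[K]_(d, n) := \matrix_(j, k) ecoord k (Z j).
have vecl := @vecof_linear K g.
have vecZ j : vecof (row j M) = Z j.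
  by rewrite -[RHS]rowofK; congr vecof; apply/rowP => k; rewrite !mxE.
pose rk := \rank M; have le_rk : (rk <= d)%N := rank_leq_row M.
pose C := col_ebase M; pose w (i : 'I_rk) : 'I_d := widen_ord le_rk i.
pose h (i : 'I_rk) : g := vecof (row i (row_base M)).
have Zh j : Z j = \sum_i C j (w i) *: h i.
  rewrite -vecZ -{1}[M]mulmx_base row_mul mulmx_sum_row (linear_sumf _ _ _ vecl).
  apply: eq_bigr => i _; rewrite (linearZf _ _ vecl); congr (_ *: _).
  rewrite !mxE (bigD1 (w i)) //= big1 => [|m /negbTE nm].
    by rewrite addr0 !mxE /= eqxx ltn_ord mulr1.
  by rewrite !mxE -[_ == _ :> nat]/(m == w i) nm mulr0.
have hZ i : h i = \sum_j pinvmx (col_base M) i j *: Z j.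
  under eq_bigr do rewrite -vecZ -(linearZf _ _ vecl).
  rewrite -(linear_sumf _ _ _ vecl); congr vecof.
  have -> : row_base M = pinvmx (col_base M) *m M.
    have := congr1 (mulmx (pinvmx (col_base M))) (mulmx_base M).
    by rewrite mulmxA mulVpmx ?mul1mx // col_base_full.
  by rewrite row_mul mulmx_sum_row; apply: eq_bigr => j _; rewrite mxE.
have hfree (c : 'I_rk -> K) : \sum_i c i *: h i = 0 -> forall i, c i = 0.
  move=> c0 i; pose u : 'rV_rk := \row_i c i.
  suff /rowP/(_ i) : u = 0 by rewrite !mxE.
  apply: (row_free_inj (row_base_free M)); rewrite /= mul0mx; apply: (can_inj (@vecofK K g)).
  rewrite (linear0f vecl) mulmx_sum_row (linear_sumf _ _ _ vecl) -[RHS]c0.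
  by apply: eq_bigr => k _; rewrite (linearZf _ _ vecl) mxE.
pose tt (i : 'I_d) : V := \sum_j C j i *: @bas K d j.
have [T TE] : exists T : d.-tuple V, forall i : 'I_d, T`_i = tt i.
  by exists [tuple tt i | i < d] => i; rewrite nth_mktuple.
have [H HE] : exists H : rk.-tuple g, forall i : 'I_rk, H`_i = h i.
  by exists [tuple h i | i < rk] => i; rewrite nth_mktuple.
have tE (i : 'I_rk) : T`_i = tt (w i).
  by rewrite -[nat_of_ord i]/(nat_of_ord (w i)) TE.
exists T, rk, H.
split.
- split=> //; last by apply/freeP => c; under eq_bigr do rewrite HE; exact: hfree.
  rewrite basisEfree subvf dimvf size_tuple /=; apply/andP; split.
    apply/freeP => c.
    under eq_bigr do rewrite TE; move=> c0 i.
    pose u : 'rV_d := \row_i c i.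
    suff /rowP/(_ i) : u = 0 by rewrite !mxE.
    apply: (row_free_inj (A := C^T)); first by rewrite row_free_unit unitmx_tr col_ebase_unit.
    rewrite /= mul0mx mulmx_sum_row -[RHS]c0; apply: eq_bigr => k _.
    rewrite mxE; congr (_ *: _); rewrite [LHS]sum_bas; apply: eq_bigr => j _.
    by rewrite /crd !mxE.
  by rewrite /dim /= mul1n.
- move=> i; rewrite HE hZ (linear_sumf _ _ _ dg_lin) big1 // => j _.
  by rewrite (linearZf _ _ dg_lin) (delta_g_Z ZE) scaler0.
- move=> x; rewrite (delta_iG ZE); congr (_ + _).
  under [RHS]eq_bigr do rewrite HE tE.
  have wb := bilin_wedge L.
  transitivity (\sum_j \sum_i C j (w i) *: wedge (iG (br (h i) x)) (iV (@bas K d j))).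
    apply: eq_bigr => j _; rewrite Zh sum_brl (linear_sumf _ _ _ iGl).
    rewrite (linear_sumf _ _ _ (wb.1 _)); apply: eq_bigr => i _.
    by rewrite brZl (linearZf _ _ iGl) (linearZf _ _ (wb.1 _)).
  rewrite exchange_big; apply: eq_bigr => i _.
  rewrite (linear_sumf _ _ _ iVl) (linear_sumf _ _ _ (wb.2 _)); apply: eq_bigr => j _.
  by rewrite (linearZf _ _ iVl) (linearZf _ _ (wb.2 _)).
- exact: delta_iV.
move=> i; rewrite tE; apply/matrixP => a b; rewrite [RHS]mxE -tlift_coord.
pose l (u v : V) : K^o := ecoord a u * ecoord b v.
have lb : bilin l by apply: bilin_scale; exact: ecoord_linear.
have := deltaV_Z ZE lb.
under eq_bigr do rewrite Zh scaler_sumr; rewrite exchange_big /=.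
under eq_bigr do (under eq_bigr do rewrite scalerA; rewrite -scaler_suml).
move/hfree/(_ i) => E; rewrite -[LHS]/(tlift l _) -[RHS]E.
rewrite (linear_sumf _ _ _ deltaV_linear) (linear_sumf _ _ _ (tlift_linear l)).
apply: eq_bigr => j _; rewrite (linearZf _ _ deltaV_linear) (linearZf _ _ (tlift_linear l)).
by rewrite mulrC.
Qed.

End Structure.

(** * Weight bases *)

Section WeightBasis.
Variables (K : fieldType) (a : lieAlg K) (h : {vspace a}).
Hypothesis hC : cartan h.
Local Notation n := (\dim {:a}%VS).

Let adm (x : a) : 'M[K]_n := \matrix_(j, k) ecoord k (br x (ebase j)).

Let admE x y : rowof (br x y) = rowof y *m adm x.
Proof.
rewrite {1}[y]ebase_sum sum_brr (linear_sumf _ _ _ (@rowof_linear K a)).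
rewrite mulmx_sum_row; apply: eq_bigr => j _.
rewrite brZr (linearZf _ _ (@rowof_linear K a)) mxE; congr (_ *: _).
by apply/rowP => k; rewrite !mxE.
Qed.

Let adm_diag x : x \in h -> diagonalizable (adm x).
Proof.
case/(cartan_diag hC) => b [/andP [_ bfree] bE].
pose P : 'M[K]_n := \matrix_(i, k) ecoord k (tnth b i).
have rowP_ i : row i P = rowof (tnth b i) by apply/rowP => k; rewrite !mxE.
have Pu : P \in unitmx.
  rewrite -row_free_unit; apply: inj_row_free => u u0; apply/rowP => i; rewrite mxE.
  move/freeP: bfree => /(_ (fun i => u 0 i)); apply.
  apply: (can_inj (@rowofK K a)); rewrite (linear0f (@rowof_linear K a)) -[RHS]u0.
  rewrite (linear_sumf _ _ _ (@rowof_linear K a)) mulmx_sum_row; apply: eq_bigr => j _.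
  by rewrite (linearZf _ _ (@rowof_linear K a)) rowP_ (tnth_nth 0).
have /choice [c cE] := bE.
exists P => //; apply/diagonalizable_forPex; exists (\row_i c i).
apply/(simmxP Pu)/row_matrixP => i.
rewrite row_mul rowP_ -admE cE (linearZf _ _ (@rowof_linear K a)) row_mul row_diag_mx.
by rewrite -scalemxAl -rowE rowP_ mxE.
Qed.

Let adm_comm x y : x \in h -> y \in h -> comm_mx (adm x) (adm y).
Proof.
move=> xh yh; apply/row_matrixP => i; rewrite !rowE.
have -> : delta_mx 0 i = rowof (ebase i : a).
  by apply/rowP => k; rewrite !mxE ecoord_ebase eqxx.
rewrite !mulmxA -!admE; congr rowof.
by rewrite [LHS]br_leibniz (cartan_abelian hC yh xh) br0l add0r.
Qed.

(** The operators ad(x) for x in h commute and are diagonalizable, so they are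
    simultaneously diagonalizable. *)
Lemma weight_basis : exists (b : 'I_n -> a) (c : 'I_n -> a -> K^o)
    (lam : 'I_n -> dual (hsub h)),
  [/\ forall j, linear (c j), forall j k, c j (b k) = (j == k)%:R,
      forall x, x = \sum_j c j x *: b j & forall j, b j \in rspace (lam j)].
Proof.
pose hb (i : 'I_(\dim h)) : a := (vbasis h)`_i.
have hbh i : hb i \in h by rewrite vbasis_mem ?mem_nth ?size_tuple.
pose fs := [seq adm (hb i) | i <- enum 'I_(\dim h)].
have [|P Pu /allP Pd] := (codiagonalizableP fs).1.
  split=> [A B|A] /mapP [i _ ->]; last exact: adm_diag.
  by case/mapP => j _ ->; exact: adm_comm.
have Pd_ i : exists D : 'rV_n, P *m adm (hb i) = diag_mx D *m P.
  have /Pd /= : adm (hb i) \in fs by apply: map_f; rewrite mem_enum.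
  by case/diagonalizable_forPex => D /(simmxP Pu); exists D.
have /choice [D DE] := Pd_.
pose b j := vecof (row j P) : a.
have hbb i j : br (hb i) (b j) = D i 0 j *: b j.
  apply: (can_inj (@rowofK K a)); rewrite admE vecofK -row_mul DE row_mul row_diag_mx.
  by rewrite -scalemxAl -rowE (linearZf _ _ (@rowof_linear K a)) vecofK.
have lamE j : exists lam : dual (hsub h), b j \in rspace lam.
  pose f (H : hsub h) : K^o := \sum_i coord (vbasis h) i (vsval H) * D i 0 j.
  have fl : linear f.
    move=> k x y; rewrite /f scaler_sumr -big_split; apply: eq_bigr => i _ /=.
    by rewrite !linearP /= mulrDl -mulrA.
  have [phi phiE] := dual_of_linear fl.
  exists phi; apply/mem_rspace => H; rewrite phiE.
  rewrite {1}(coord_vbasis (valP H : vsval H \in h)) sum_brl scaler_suml.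
  by apply: eq_bigr => i _; rewrite brZl hbb scalerA.
have /choice [lam lamh] := lamE.
exists b, (fun j x => (rowof x *m invmx P) 0 j), lam; split=> // [j k x y|j k|x].
- by rewrite rowof_linear mulmxDl -scalemxAl !mxE.
- by rewrite vecofK -row_mul mulmxV // mxE mxE eq_sym.
apply: (can_inj (@rowofK K a)); rewrite (linear_sumf _ _ _ (@rowof_linear K a)).
rewrite -[LHS](mulmxKV Pu) mulmx_sum_row; apply: eq_bigr => j _.
by rewrite (linearZf _ _ (@rowof_linear K a)) vecofK.
Qed.

End WeightBasis.

(** * Invariant forms *)

Section InvForm.
Variables (K : fieldType) (a : lieAlg K) (B : a -> a -> K).
Hypothesis HB : inv_form B.

Lemma form_linl y : linear (B^~ y : a -> K^o).
Proof. exact: (inv_form_linl HB). Qed.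

Lemma form_linr x : linear (B x : a -> K^o).
Proof. by move=> c y z; rewrite !(inv_form_sym HB x); exact: form_linl. Qed.

Lemma form_brl x y z : B (br x y) z = - B y (br x z).
Proof.
rewrite br_anti (linearNf _ (form_linl z)) (inv_form_inv HB); by [].
Qed.

(** The operator on a defined by a tensor: y |-> (B(y, .) (x) id) t. *)
Definition ctr (y : a) (t : tens a a) : a := tlift (fun u v => B y u *: v) t.

Lemma bilin_ctr y : bilin (fun u v : a => B y u *: v).
Proof. exact: bilin_scale (form_linr y) (@linear_id _ _). Qed.

Lemma ctr_linear y : linear (ctr y).
Proof. exact: tlift_linear. Qed.

Lemma ctr_pure y u v : ctr y (pure u v) = B y u *: v.
Proof. exact: tliftP (bilin_ctr y). Qed.

Lemma ctr_ad z y t : ctr y (ad2 z t) = br z (ctr y t) - ctr (br z y) t.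
Proof.
rewrite /ctr tlift_ad2; last exact: bilin_ctr.
rewrite (linear_tlift _ _ (br_linr z)) -tlift_opp -tlift_add; apply: eq_tlift => u v.
by rewrite brZr form_brl scaleNr opprK addrC.
Qed.

Lemma ctr_inj t : (forall y, ctr y t = 0) -> t = 0.
Proof.
move=> t0; apply/matrixP => i j; rewrite [RHS]mxE.
have : \sum_i (t : 'M_(_, _)) i j *: ebase i = 0 :> a.
  apply: (inv_form_nondeg HB) => y; rewrite (inv_form_sym HB).
  transitivity (ecoord j (ctr y t)); last by rewrite t0; exact: linear0f (ecoord_linear j).
  rewrite /ctr (linear_tlift _ _ (ecoord_linear j)) /tlift (linear_sumf _ _ _ (form_linr y)).
  apply: eq_bigr => k _; rewrite (linearZf _ _ (form_linr y)).
  rewrite (bigD1 j) //= big1 => [|m /negbTE nm]; rewrite (linearZf _ _ (ecoord_linear j)) ecoord_ebase.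
    by rewrite eqxx addr0 -[RHS]/(_ * (_ * _)) mulr1.
  by rewrite eq_sym nm -[LHS]/(_ * (_ * _)) !mulr0.
move/(congr1 (ecoord i)); rewrite ecoord_lincomb => ->.
exact: linear0f (ecoord_linear i).
Qed.

Lemma ctr_casimir y : ctr y (casimir B) = y.
Proof.
pose G : 'M[K]_(\dim {:a}%VS) := \matrix_(i, j) B (ebase i) (ebase j).
have BG z j : B z (ebase j) = (rowof z *m G) 0 j.
  rewrite {1}[z]ebase_sum (linear_sumf _ _ _ (form_linl _)) mxE.
  by apply: eq_bigr => i _; rewrite (linearZf _ _ (form_linl _)) !mxE.
have Gu : G \in unitmx.
  rewrite -row_free_unit; apply: inj_row_free => u u0.
  rewrite -[u]vecofK (inv_form_nondeg HB (x := vecof u)) => [|z].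
    by apply/rowP => k; rewrite !mxE; exact: linear0f (ecoord_linear (V := a) k).
  rewrite [z]ebase_sum (linear_sumf _ _ _ (form_linr _)) big1 // => j _.
  by rewrite (linearZf _ _ (form_linr _)) BG vecofK u0 mxE; exact: mulr0.
rewrite /ctr /tlift exchange_big [RHS]ebase_sum; apply: eq_bigr => j _ /=.
under eq_bigr do rewrite scalerA.
rewrite -scaler_suml; congr (_ *: _).
transitivity ((rowof y *m G *m invmx G) 0 j); last by rewrite mulmxK // mxE.
by rewrite mxE; apply: eq_bigr => i _; rewrite BG mulrC.
Qed.

Lemma ctr_linl t : linear (ctr^~ t).
Proof.
move=> c y z; rewrite /ctr -tlift_scale -tlift_add; apply: eq_tlift => u v.
by rewrite (form_linl u c y z) scalerDl scalerA.
Qed.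

(** The operator D of an antisymmetric invariant tensor is antisymmetric for B
    and commutes with ad. Together these make B([z, D y], w) equal to its
    opposite, so that D y is central. *)
Lemma no_antisym_invariants :
  2%:R != 0 :> K ->
  (forall z : a, (forall x, br x z = 0) -> z = 0) ->
  forall t : tens a a, flip t = - t -> (forall x, ad2 x t = 0) -> t = 0.
Proof.
move=> char2 cl t ta ti; apply: ctr_inj => y; apply: cl => z.
have c w u : br w (ctr u t) = ctr (br w u) t.
  by apply/eqP; rewrite -subr_eq0 -ctr_ad ti (linear0f (ctr_linear u)).
have s u w : B (ctr u t) w = - B u (ctr w t) :> K^o.
  have -> : B (ctr u t) w = @tlift K a a _ (fun p q => B u p * B w q : K^o) t :> K^o.
    rewrite (inv_form_sym HB) [LHS](linear_tlift _ _ (form_linr w)).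
    by apply: eq_tlift => p q; rewrite (linearZf _ _ (form_linr w)).
  have b : @bilin K a a _ (fun p q : a => B u p * B w q : K^o).
    exact: bilin_scale (form_linr u) (form_linr w).
  transitivity (@tlift K a a _ (fun p q => B u p * B w q : K^o) (- flip t) : K^o); first by rewrite ta opprK.
  rewrite (linearNf _ (tlift_linear _)) tlift_flip //; congr (- _).
  rewrite [RHS](linear_tlift _ _ (form_linr u)).
  apply: eq_tlift => p q; rewrite (linearZf _ _ (form_linr u)); exact: mulrC.
apply: (inv_form_nondeg HB) => w.
have c' u v : ctr (br u v) t = br (ctr u t) v.
  by rewrite br_anti (linearNf _ (ctr_linl t)) -c [RHS]br_anti.
(* B([z,Dy],w) = B(z,D[y,w]) = -B(Dz,[y,w]) = -B([Dz,y],w) = -B([z,Dy],w) *)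
have X : B (br z (ctr y t)) w = - B (br z (ctr y t)) w.
  rewrite {1}(inv_form_inv HB) -c' -[LHS]opprK -s -(inv_form_inv HB) -c'.
  by rewrite c.
have /eqP : 2%:R * B (br z (ctr y t)) w = 0 by rewrite mulr_natl mulr2n {2}X subrr.
by rewrite mulf_eq0 (negbTE char2) => /eqP.
Qed.

End InvForm.

(** * Roots *)

Section Roots.
Variables (K : numFieldType) (a : lieAlg K) (h : {vspace a}) (B : a -> a -> K).
Variables (Phi : seq (dual (hsub h))) (l : nat) (Delta : l.-tuple (dual (hsub h))).
Hypothesis HB : inv_form B.
Hypothesis hC : cartan h.
Hypothesis HPhi : enumerates_roots Phi.
Hypothesis HS : simple_roots Delta Phi.
Implicit Types (al be ga : dual (hsub h)) (H : hsub h).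
Local Notation pos := (pos_roots Delta Phi).

Lemma rspaceP al x H : x \in rspace al -> br (vsval H) x = al H *: x.
Proof. by move/mem_rspace. Qed.

Lemma mem_h_rspace x : (x \in h) <-> (x \in rspace (0 : dual (hsub h))).
Proof.
split=> [xh|/mem_rspace x0].
  by apply/mem_rspace => H; rewrite zero_lfunE scale0r (cartan_abelian hC) ?subvsP.
apply: (cartan_selfcentral hC) => y yh.
by rewrite -(vsprojK yh) x0 zero_lfunE scale0r.
Qed.

Lemma br_rspace al be x y :
  x \in rspace al -> y \in rspace be -> br x y \in rspace (al + be).
Proof.
move=> /mem_rspace xa /mem_rspace yb; apply/mem_rspace => H.
by rewrite br_leibniz xa yb brZl brZr add_lfunE scalerDl.
Qed.

Lemma rspace_orth al be x y : x \in rspace al -> y \in rspace be ->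
  al + be != 0 -> B x y = 0.
Proof.
move=> xa yb; apply: contraNeq => Bxy; apply/eqP/lfunP => H.
rewrite add_lfunE zero_lfunE; have := form_brl HB (vsval H) x y.
rewrite (rspaceP H xa) (rspaceP H yb) (linearZf _ _ (form_linl HB y)).
rewrite (linearZf _ _ (form_linr HB x)) => /eqP.
rewrite -addr_eq0 -[_ + _]/(al H * B x y + be H * B x y) -mulrDl mulf_eq0.
by rewrite (negbTE Bxy) orbF => /eqP.
Qed.

Lemma Phi_root al : al \in Phi -> al != 0 /\ rspace al != 0%VS.
Proof. by case: HPhi => _ /(_ al) [+ _] => /[apply]. Qed.

(** Generation by h and the root spaces, in the form of an induction principle;
    directness of the sum is recovered from the form B. *)
Lemma weight_ind (P : a -> Prop) :
  P 0 -> (forall c x y, P x -> P y -> P (c *: x + y)) ->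
  (forall x, x \in h -> P x) ->
  (forall al x, al \in Phi -> x \in rspace al -> P x) -> forall x, P x.
Proof.
move=> P0 PD Ph PPhi x; have [b [c [lam [cl cb xE blam]]]] := weight_basis hC.
have Pb j : P (b j).
  have [lam0|lamN0] := eqVneq (lam j) 0.
    by apply/Ph/mem_h_rspace; rewrite -lam0.
  apply: (PPhi (lam j)) => //; case: HPhi => _ /(_ (lam j)) [_]; apply; split=> //.
  apply: contraTneq (blam j) => ->; rewrite memv0; apply/negP => /eqP bj0.
  by have := cb j j; rewrite bj0 (linear0f (cl j)) eqxx => /esym/eqP; rewrite oner_eq0.
by rewrite (xE x); elim/big_rec: _ => [|j y _ Py]; [exact: P0 | exact: PD].
Qed.

Lemma linear_ext0 (U : lmodType K) (F : a -> U) : linear F ->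
  (forall x, x \in h -> F x = 0) ->
  (forall al x, al \in Phi -> x \in rspace al -> F x = 0) -> forall x, F x = 0.
Proof.
move=> Fl; apply: weight_ind => [|c x y Fx Fy]; first exact: linear0f Fl.
by rewrite Fl Fx Fy scaler0 addr0.
Qed.

Lemma h_orth al x y : x \in h -> al \in Phi -> y \in rspace al -> B x y = 0.
Proof.
move=> /mem_h_rspace xh /Phi_root [aN0 _] ya.
by rewrite (rspace_orth xh ya) // add0r.
Qed.

(** If the opposite root space were zero, the root space of al would be
    orthogonal to everything. *)
Lemma neg_root al : al \in Phi -> - al \in Phi.
Proof.
move=> aP; have [aN0 ra] := Phi_root aP.
case: HPhi => _ /(_ (- al)) [_]; apply; split; first by rewrite oppr_eq0.
apply: contra ra => /eqP ra; rewrite -vpick0; apply/eqP.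
have ya := memv_pick (rspace al); apply: (inv_form_nondeg HB).
apply: (linear_ext0 (form_linr HB _)) => [x xh|be x bP xb].
  by rewrite (inv_form_sym HB) (h_orth xh aP ya).
have [e|] := eqVneq (al + be) 0; last exact: rspace_orth ya xb.
have be_ : be = - al by apply/eqP; rewrite -addr_eq0 addrC e.
move: xb; rewrite be_ ra memv0 => /eqP ->; exact: linear0f (form_linr HB _).
Qed.

Local Notation W := (\sum_(al <- Phi) rspace al)%VS.

Lemma W_orth x y : x \in h -> y \in W -> B x y = 0.
Proof.
move=> xh; have [phi phiE] := dual_of_linear (form_linr HB x).
suff WW : (W <= lker phi)%VS by move/(subvP WW); rewrite memv_ker phiE => /eqP.
rewrite big_seq; apply: (big_ind (fun U => (U <= lker phi)%VS)).
- exact: sub0v.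
- by move=> U1 U2 s1 s2; rewrite subv_add s1 s2.
move=> al aP; apply/subvP => z za; rewrite memv_ker phiE; apply/eqP.
exact: h_orth xh aP za.
Qed.

Lemma rspace_sub_W al : al \in Phi -> (rspace al <= W)%VS.
Proof. by move=> aP; rewrite (big_rem al) //= addvSl. Qed.

Lemma h_cap_W : (h :&: W = 0)%VS.
Proof.
apply/eqP; rewrite -subv0; apply/subvP => x; rewrite memv_cap => /andP [xh xW].
rewrite memv0; apply/eqP/(inv_form_nondeg HB).
apply: (linear_ext0 (form_linr HB _)) => [y yh|al y aP ya].
  by rewrite (inv_form_sym HB) (W_orth yh xW).
exact: h_orth xh aP ya.
Qed.

Lemma h_add_W x : x \in (h + W)%VS.
Proof.
apply: (weight_ind (P := fun x => x \in (h + W)%VS)) => [|c y z yh zh|y yh|al y aP ya].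
- exact: mem0v.
- by rewrite memvD ?memvZ.
- by rewrite (subvP (addvSl _ _)).
by rewrite (subvP (addvSr _ _)) // (subvP (rspace_sub_W aP)).
Qed.

Lemma hproj_linear : linear (@hproj K a h Phi).
Proof. by move=> c x y; rewrite /hproj !linearP. Qed.

Lemma hproj_h H : hproj Phi (vsval H) = H.
Proof. by rewrite /hproj daddv_pi_id ?subvsP ?h_cap_W // vsvalK. Qed.

Lemma form_hproj x y : x \in h -> B x (vsval (hproj Phi y)) = B x y.
Proof.
move=> xh; rewrite /hproj vsprojK ?memv_pi // -[in RHS](daddv_pi_add h_cap_W (h_add_W y)).
by rewrite (linearDf _ _ (form_linr HB x)) (W_orth xh (memv_pi _ _ _)) addr0.
Qed.

Lemma Delta_basis : basis_of {:dual (hsub h)}%VS Delta.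
Proof. by case: HS. Qed.

Lemma Delta_free : free Delta. Proof. exact: basis_free Delta_basis. Qed.

Lemma Delta_sep H : (forall i : 'I_l, Delta`_i H = 0) -> H = 0.
Proof.
move=> H0; apply: ecoordP => k; rewrite [RHS](linear0f (ecoord_linear k)).
have [phi phiE] := dual_of_linear (ecoord_linear (V := hsub h) k).
rewrite -[LHS]phiE (coord_basis Delta_basis (memvf phi)) sum_lfunE big1 // => i _.
by rewrite scale_lfunE H0; exact: mulr0.
Qed.

Lemma mem_pos al : (al \in pos) <-> (positive Delta al /\ al \in Phi).
Proof.
rewrite mem_filter; split=> [/andP [/asboolP p aP]|[p aP]]; first by split.
by apply/andP; split=> //; apply/asboolP.
Qed.

Lemma pos_sub al : al \in pos -> al \in Phi. Proof. by case/mem_pos. Qed.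

Lemma pos_uniq : uniq pos.
Proof. by rewrite filter_uniq //; case: HPhi. Qed.

Lemma Delta_pos (i : 'I_l) : Delta`_i \in pos.
Proof.
case: HS => _ DP _; apply/mem_pos; split; last by rewrite DP // mem_nth // size_tuple.
exists (fun j => (j == i)%N : nat); rewrite (bigD1 i) //= eqxx mulr1n big1 ?addr0 //.
by move=> j /negbTE ->; rewrite mulr0n.
Qed.

Lemma pos_root_sep H : (forall al, al \in pos -> al H = 0) -> H = 0.
Proof. by move=> H0; apply: Delta_sep => i; exact/H0/Delta_pos. Qed.

Lemma pos_add_neq0 al be : al \in pos -> be \in pos -> al + be != 0.
Proof.
move=> /mem_pos [[c cE] /Phi_root [aN0 _]] /mem_pos [[d dE] _].
apply: contra aN0 => /eqP e.
have := Delta_free => /freeP /(_ (fun i => (c i + d i)%:R)) f.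
rewrite cE big1 // => i _; suff /eqP : (c i + d i)%N = 0%N.
  by rewrite addn_eq0 => /andP [/eqP -> _].
apply/eqP; rewrite -(pnatr_eq0 K); apply/eqP; apply: f; rewrite -[RHS]e cE dE -big_split.
by apply: eq_bigr => j _; rewrite scaler_nat mulrnDr.
Qed.

End Roots.

(** * Root vectors and the symmetric part of r *)

Section BDData.
Variables (K : numFieldType) (a : lieAlg K) (h : {vspace a}) (B : a -> a -> K).
Variables (Phi : seq (dual (hsub h))) (l : nat) (Delta : l.-tuple (dual (hsub h))).
Variables (G1 G2 : {set 'I_l}) (tau : 'I_l -> 'I_l) (r0 : tens (hsub h) (hsub h)).
Variable (x : dual (hsub h) -> a).
Hypothesis HB : inv_form B.
Hypothesis hC : cartan h.
Hypothesis HPhi : enumerates_roots Phi.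
Hypothesis HS : simple_roots Delta Phi.
Hypothesis HT : BD_triple Delta G1 G2 tau B Phi.
Hypothesis Hr0 : cont_param Delta G1 tau B Phi r0.
Hypothesis Hx : root_vectors Delta B Phi x.
Local Notation r := (BD_formula Delta G1 G2 tau Phi r0 x).
Hypothesis Hr : forall y, flip (ad2 y r) = - ad2 y r.
Implicit Types (al be ga : dual (hsub h)) (H : hsub h).
Local Notation pos := (pos_roots Delta Phi).
Local Notation prec := (prec Delta G1 G2 tau Phi).
Local Notation vs := (fun u : hsub h => vsval u).

Lemma vs_linear : linear vs. Proof. by move=> c u v; rewrite linearP. Qed.

Lemma xpos al : al \in pos -> x al \in rspace al.
Proof. by move=> /(pos_sub) aP; case: Hx => + _; exact. Qed.

Lemma xneg al : al \in pos -> x (- al) \in rspace (- al).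
Proof. by move=> /(pos_sub) aP; case: Hx => + _; apply; exact: (neg_root HB hC HPhi). Qed.

Lemma form_xx be ga : be \in pos -> ga \in pos ->
  B (x be) (x (- ga)) = (be == ga)%:R.
Proof.
move=> bP gP; have [<-|bg] := eqVneq be ga; first by case: Hx => _ ->.
by rewrite (rspace_orth HB (xpos bP) (xneg gP)) // subr_eq0.
Qed.

Lemma form_xpp be ga : be \in pos -> ga \in pos -> B (x be) (x ga) = 0.
Proof.
move=> bP gP; apply: (rspace_orth HB (xpos bP) (xpos gP)).
exact: (pos_add_neq0 HPhi HS).
Qed.

Lemma form_xnn be ga : be \in pos -> ga \in pos -> B (x (- be)) (x (- ga)) = 0.
Proof.
move=> bP gP; apply: (rspace_orth HB (xneg bP) (xneg gP)).
by rewrite -opprD oppr_eq0 (pos_add_neq0 HPhi HS).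
Qed.

Lemma form_hx H al : al \in pos -> B (vsval H) (x al) = 0.
Proof. by move=> aP; apply: (h_orth HB hC HPhi) (pos_sub aP) (xpos aP); exact: subvsP. Qed.

Lemma form_hxn H al : al \in pos -> B (vsval H) (x (- al)) = 0.
Proof.
move=> aP; apply: (h_orth HB hC HPhi) (neg_root HB hC HPhi (pos_sub aP)) (xneg aP).
exact: subvsP.
Qed.

(** The analogue of [ctr] for tensors over h. *)
Definition ctrh (y : a) (s : tens (hsub h) (hsub h)) : hsub h :=
  tlift (fun u v : hsub h => B y (vsval u) *: v) s.

Lemma ctr_h y s : ctr B y (tmap vs vs s) = vsval (ctrh y s).
Proof.
rewrite /ctr tlift_tmap; last exact: (bilin_ctr HB).
by rewrite [RHS](linear_tlift _ _ vs_linear); apply: eq_tlift => u v; rewrite linearZ.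
Qed.

Lemma ctrh_Omega0 H : ctrh (vsval H) (Omega0 B Phi) = H.
Proof.
rewrite /ctrh /Omega0 tlift_tmap; last first.
  exact: bilin_scale (linear_comp (form_linr HB _) vs_linear) (@linear_id _ _).
rewrite -[RHS](hproj_h HB hC HPhi) -[X in _ = hproj _ X](ctr_casimir HB).
rewrite [RHS](linear_tlift _ _ (@hproj_linear K a h Phi)).
apply: eq_tlift => u v.
by rewrite (linearZf _ _ (@hproj_linear K a h Phi)) (form_hproj HB hC HPhi) ?subvsP.
Qed.

Definition symr : tens a a := r + flip r.

Lemma symrE : symr = tmap vs vs (Omega0 B Phi)
  + \sum_(al <- pos) (pure (x (- al)) (x al) + pure (x al) (x (- al))).
Proof.
have fX : flip (\sum_(al <- pos) pure (x (- al)) (x al))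
    = \sum_(al <- pos) pure (x al) (x (- al)).
  by rewrite (linear_sumf _ _ _ (@flip_linear K a)); apply: eq_bigr => al _; rewrite flip_pure.
pose Y := \sum_(al <- pos) \sum_(be <- pos | `[< prec al be >])
   (pure (x (- al)) (x be) - pure (x be) (x (- al))).
have fY : flip Y = - Y.
  rewrite /Y (linear_sumf _ _ _ (@flip_linear K a)) -sumrN; apply: eq_bigr => al _.
  rewrite (linear_sumf _ _ _ (@flip_linear K a)) -sumrN; apply: eq_bigr => be _.
  by rewrite (linearDf _ _ (@flip_linear K a)) (linearNf _ (@flip_linear K a)) !flip_pure opprB.
case: Hr0 => _ <-; rewrite /symr /BD_formula -/Y.
rewrite 2!(linearDf _ _ (@flip_linear K a)) fX fY -(tmap_flip _ vs_linear).
rewrite (linearDf _ _ (tmap_linear _ _)) big_split /=.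
by rewrite addrACA subrr addr0 addrACA.
Qed.

Lemma symr_inv y : ad2 y symr = 0.
Proof. by rewrite /symr linearD /= -flip_ad2 Hr subrr. Qed.

Lemma flip_symr : flip symr = symr.
Proof. by rewrite /symr linearD /= flipK addrC. Qed.

Lemma ctr_sum_symr y : ctr B y symr = vsval (ctrh y (Omega0 B Phi))
  + \sum_(al <- pos) (B y (x (- al)) *: x al + B y (x al) *: x (- al)).
Proof.
have cl := ctr_linear B y; rewrite symrE (linearDf _ _ cl) ctr_h (linear_sumf _ _ _ cl).
congr (_ + _); apply: eq_bigr => al _.
by rewrite (linearDf _ _ cl) !(ctr_pure HB).
Qed.

(** On h this is the definition of Omega0; on a root space it follows because
    the operator of an invariant tensor commutes with ad(h). In particular the
    root spaces are lines spanned by the chosen root vectors. *)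
Lemma ctr_symr y : ctr B y symr = y.
Proof.
apply/eqP; rewrite -subr_eq0; apply/eqP; move: y.
have dl : linear (fun y => ctr B y symr - y).
  exact: linear_sub (ctr_linl HB symr) (@linear_id _ _).
have Eh H : ctr B (vsval H) symr = vsval H.
  rewrite ctr_sum_symr ctrh_Omega0 big_seq big1 ?addr0 // => al aP.
  by rewrite (form_hx H aP) (form_hxn H aP) !scale0r addr0.
apply: (linear_ext0 hC HPhi dl) => [y yh|al y aP ya].
  by rewrite -(vsprojK yh) Eh subrr.
have [H HN0] : exists H, al H != 0.
  apply: contrapT => nE; have [/eqP aN0 _] := Phi_root HPhi aP; apply: aN0.
  apply/lfunP => H; rewrite zero_lfunE; apply/eqP; apply: contrapT => aH.
  by apply: nE; exists H; apply/negP.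
(* al(H) (S y) = S [H, y] = - [y, S H] = - [y, H] = al(H) y *)
apply/eqP; rewrite -[_ == _]orFb -(negbTE HN0) -scaler_eq0 scalerBr subr_eq0; apply/eqP.
rewrite -(rspaceP H ya) -(linearZf _ _ (ctr_linl HB symr)) -(rspaceP H ya).
have c z w : ctr B (br z w) symr = br z (ctr B w symr).
  apply/eqP; rewrite eq_sym -subr_eq0 -(ctr_ad HB) symr_inv.
  by rewrite (linear0f (ctr_linear B _)).
by rewrite br_anti (linearNf _ (ctr_linl HB symr)) c Eh.
Qed.

Lemma root_expansion y : y = vsval (ctrh y (Omega0 B Phi))
  + \sum_(al <- pos) (B y (x (- al)) *: x al + B y (x al) *: x (- al)).
Proof. by rewrite -ctr_sum_symr ctr_symr. Qed.

Lemma in_h_of_form y :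
  (forall al, al \in pos -> B y (x al) = 0) ->
  (forall al, al \in pos -> B y (x (- al)) = 0) -> y \in h.
Proof.
move=> yp yn; rewrite (root_expansion y) big_seq big1 ?addr0 ?subvsP // => al aP.
by rewrite (yp _ aP) (yn _ aP) !scale0r addr0.
Qed.

(** This is the element of h dual to al under B, cf. [form_coroot]; the
    normalization differs from that of the usual coroot. *)
Definition coroot al : a := br (x al) (x (- al)).

Lemma coroot_h al : al \in pos -> coroot al \in h.
Proof.
move=> aP; apply/(mem_h_rspace hC); rewrite -(subrr al).
exact: br_rspace (xpos aP) (xneg aP).
Qed.

Lemma form_coroot al H : al \in pos -> B (coroot al) (vsval H) = al H.
Proof.
move=> aP; rewrite /coroot (inv_form_inv HB) br_anti (rspaceP H (xneg aP)).
rewrite -scaleNr opp_lfunE opprK (linearZf _ _ (form_linr HB _)).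
by case: Hx => _ -> //; exact: mulr1.
Qed.

Definition hcoroot al : hsub h := vsproj h (coroot al).

Lemma vs_hcoroot al : al \in pos -> vsval (hcoroot al) = coroot al.
Proof. by move/coroot_h => ch; rewrite vsprojK. Qed.

(** The span of the weight spaces of weights be + n al is stable under x_al and
    x_-al, so their commutator t_al has trace 0 on it. *)
Lemma root_string_ratio al be : al \in pos -> be \in Phi ->
  exists q : rat, be (hcoroot al) = ratr q * al (hcoroot al).
Proof.
move=> aP bP; have [b [c [lam [cl cb bE blam]]]] := weight_basis hC.
have cy j ga y : y \in rspace ga -> c j y != 0 -> lam j = ga.
  move=> yg cN0; apply/lfunP => H; have := congr1 (c j) (rspaceP H yg).
  rewrite (linearZf _ _ (cl j)) {1}(bE y) sum_brr (linear_sumf _ _ _ (cl j)).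
  rewrite (bigD1 j) //= big1 => [|k /negbTE nk].
    rewrite addr0 brZr (rspaceP H (blam j)) !(linearZf _ _ (cl j)) cb eqxx.
    rewrite -[LHS]/(_ * (_ * _)) mulr1 mulrC -[RHS]/(_ * _); exact: mulIf.
  rewrite brZr (rspaceP H (blam k)) !(linearZf _ _ (cl j)) cb eq_sym nk.
  by rewrite -[LHS]/(_ * (_ * _)) !mulr0.
pose J j := `[< exists n : int, lam j = be + al *~ n >].
have [j0 Jj0] : exists j, J j.
  apply: contrapT => nE; have [_ /eqP rb] := Phi_root HPhi bP; apply: rb.
  apply/eqP; rewrite -vpick0 [vpick _]bE big1 // => j _.
  have [->|cN0] := eqVneq (c j (vpick (rspace be))) 0; first by rewrite scale0r.
  case: nE; exists j; apply/asboolP; exists 0.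
  by rewrite mulr0z addr0; apply: cy cN0; exact: memv_pick.
have shift (n : int) j k : lam j = lam k + al *~ n -> J k -> J j.
  by move=> e /asboolP [m mE]; apply/asboolP; exists (m + n); rewrite e mE mulrzDr addrA.
pose X j k := c j (br (x al) (b k)); pose Y j k := c j (br (x (- al)) (b k)).
have XJ j k : X j k != 0 -> J j = J k.
  move/(cy _ _ _ (br_rspace (xpos aP) (blam k))) => e.
  apply/idP/idP; first by apply: (shift (-1)); rewrite mulrN1z e addrAC subrr add0r.
  by apply: (shift 1); rewrite mulr1z e addrC.
have YJ j k : Y j k != 0 -> J j = J k.
  move/(cy _ _ _ (br_rspace (xneg aP) (blam k))) => e.
  apply/idP/idP; first by apply: (shift 1); rewrite mulr1z e addrAC addNr add0r.
  by apply: (shift (-1)); rewrite mulrN1z e addrC.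
set t := hcoroot al.
have lamt j : lam j t = \sum_k (X j k * Y k j - Y j k * X k j).
  have : c j (br (vsval t) (b j)) = lam j t.
    by rewrite (rspaceP t (blam j)) (linearZf _ _ (cl j)) cb eqxx; exact: mulr1.
  rewrite vs_hcoroot // => <-.
  have -> : br (coroot al) (b j)
      = br (x al) (br (x (- al)) (b j)) - br (x (- al)) (br (x al) (b j)).
    by rewrite (br_leibniz (x al)) addrK.
  rewrite {1}(bE (br (x (- al)) (b j))) {1}(bE (br (x al) (b j))) !sum_brr -sumrB.
  rewrite (linear_sumf _ _ _ (cl j)); apply: eq_bigr => k _.
  rewrite !brZr (linearDf _ _ (cl j)) (linearNf _ (cl j)) !(linearZf _ _ (cl j)).
  by rewrite mulrC [X in _ - X]mulrC.
have trace0 : \sum_(j | J j) lam j t = 0.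
  transitivity (\sum_(j | J j) \sum_(k | J k) (X j k * Y k j - Y j k * X k j)).
    apply: eq_bigr => j Jj; rewrite lamt [LHS](bigID J) /= [X in _ + X]big1 ?addr0 // => k nJk.
    have [->|/XJ] := eqVneq (X j k) 0; last by rewrite Jj (negbTE nJk).
    have [->|/YJ] := eqVneq (Y j k) 0; last by rewrite Jj (negbTE nJk).
    by rewrite !mul0r subrr.
  under eq_bigr do rewrite sumrB; rewrite sumrB [X in _ - X]exchange_big /=.
  apply/eqP; rewrite subr_eq0; apply/eqP.
  by apply: eq_bigr => j _; apply: eq_bigr => k _; rewrite mulrC.
have nE j : exists n : int, J j -> lam j = be + al *~ n.
  by case: (asboolP (exists n : int, lam j = be + al *~ n)) => [[n e]|nJ];
    [exists n | exists 0 => /asboolP].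
have /choice [n nJ] := nE.
have mulz (m : int) : (al *~ m) t = m%:~R * al t.
  by rewrite -scaler_int scale_lfunE.
have E : #|[pred j | J j]|%:R * be t + (\sum_(j | J j) n j)%:~R * al t = 0.
  rewrite -[RHS]trace0 rmorph_sum /= mulr_suml.
  rewrite -[X in X * be t]mulr_natl mulr1 -mulr_natl mulr1.
  rewrite mulr_natl -sumr_const -big_split /=; apply: eq_bigr => j Jj.
  by rewrite (nJ j Jj) add_lfunE mulz.
have cardN0 : #|[pred j | J j]|%:R != 0 :> K.
  by rewrite pnatr_eq0 -lt0n; apply/card_gt0P; exists j0.
exists (- (\sum_(j | J j) n j)%:~R / #|[pred j | J j]|%:R).
rewrite fmorph_div rmorphN /= ratr_int ratr_nat mulrAC mulNr.
apply: (mulfI cardN0); rewrite mulrC [RHS]mulrCA mulfV // mulr1.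
by apply/eqP; rewrite -addr_eq0 mulrC E.
Qed.

Lemma root_coroot_neq0 al : al \in pos -> al (hcoroot al) != 0.
Proof.
move=> aP; apply/eqP => a0; have [/eqP aN0 _] := Phi_root HPhi (pos_sub aP); apply: aN0.
have t0 : hcoroot al = 0.
  apply: (pos_root_sep HS) => be bP.
  by have [q ->] := root_string_ratio aP (pos_sub bP); rewrite a0 mulr0.
apply/lfunP => H; rewrite zero_lfunE -(form_coroot H aP) -(vs_hcoroot aP) t0 linear0.
exact: linear0f (form_linl HB _).
Qed.

Lemma centreless (z : a) : (forall y, br y z = 0) -> z = 0.
Proof.
move=> zc; have zh : z \in h by apply: (cartan_selfcentral hC) => y _; exact: zc.
rewrite -(vsprojK zh); suff -> : vsproj h z = 0 by rewrite linear0.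
apply: (pos_root_sep HS) => al aP.
have := rspaceP (vsproj h z) (xpos aP).
rewrite vsprojK // br_anti zc oppr0 => /(congr1 (fun y => B y (x (- al)))).
rewrite (linearZf _ _ (form_linl HB _)) (linear0f (form_linl HB _)) form_xx // eqxx.
by rewrite -[RHS]/(_ * _) mulr1.
Qed.

(** The Casimir operator of the adjoint representation, with S in place of the
    Casimir element. *)
Definition casop (z : a) : a := tlift (fun u v => br u (br v z)) symr.

Lemma bilin_casop z : bilin (fun u v : a => br u (br v z)).
Proof. exact: (bilin_comp (bilin_br a) (@linear_id _ _) (@br_linl _ a z)). Qed.

Lemma casop_linear : linear casop.
Proof.
move=> c y z; rewrite /casop -tlift_scale -tlift_add; apply: eq_tlift => u v.
by rewrite !br_linr.
Qed.

Lemma casop_br (y z : a) : br y (casop z) = casop (br y z).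
Proof.
have := congr1 (tlift (fun u v : a => br u (br v z))) (symr_inv y).
rewrite linear0 tlift_ad2; last exact: bilin_casop.
rewrite /casop (linear_tlift _ _ (br_linr y)) => e.
apply/eqP; rewrite -subr_eq0; apply/eqP; rewrite -[RHS]e -tlift_opp -tlift_add.
apply: eq_tlift => u v; rewrite [br y (br u _)]br_leibniz [br y (br v _)]br_leibniz.
by rewrite !brDr addrA addrK.
Qed.

Lemma casop_brl (y z : a) : br (casop z) y = casop (br z y).
Proof. by rewrite br_anti casop_br -(linearNf _ casop_linear) -br_anti. Qed.

Lemma form_casop y z : B (casop z) y = B z (casop y) :> K^o.
Proof.
transitivity (tlift (fun u v => B (br u (br v z)) y : K^o) symr : K^o).
  exact: (linear_tlift _ _ (form_linl HB y)).
transitivity (tlift (fun u v => B z (br v (br u y)) : K^o) symr : K^o).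
  by apply: eq_tlift => u v; rewrite (form_brl HB) (form_brl HB) opprK.
rewrite -[in LHS]flip_symr tlift_flip; last first.
  exact: (bilin_swap (linear_bilin (form_linr HB z) (bilin_casop y))).
by symmetry; exact: (linear_tlift _ _ (form_linr HB z)).
Qed.

Lemma casop_h H :
  casop (vsval H) = vsval (\sum_(al <- pos) (2%:R * al H) *: hcoroot al).
Proof.
rewrite /casop symrE (linearDf _ _ (@tlift_linear _ _ _ _ _)) tlift_tmap; last exact: bilin_casop.
have -> : tlift (fun u v : hsub h => br (vsval u) (br (vsval v) (vsval H))) (Omega0 B Phi) = 0.
  rewrite -[RHS](tlift0 a (Omega0 B Phi)); apply: eq_tlift => u v.
  by rewrite (cartan_abelian hC (subvsP v) (subvsP H)) br0r.
rewrite add0r (linear_sumf _ _ _ (@tlift_linear _ _ _ _ _)) linear_sum big_seq [RHS]big_seq.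
apply: eq_bigr => al aP; rewrite (linearDf _ _ (@tlift_linear _ _ _ _ _)).
rewrite !tliftP; try exact: bilin_casop.
rewrite linearZ /= vs_hcoroot // /coroot.
rewrite [br (x al) (vsval H)]br_anti [br (x (- al)) (vsval H)]br_anti.
rewrite (rspaceP H (xpos aP)) (rspaceP H (xneg aP)) opp_lfunE scaleNr opprK brNr !brZr.
rewrite [br (x (- al)) _]br_anti scalerN opprK -scalerDl; congr (_ *: _).
by rewrite mulr_natl mulr2n.
Qed.

(** C is symmetric, so an element z of its kernel is orthogonal to the image of
    C, an ideal. This ideal contains C t_ga, on which ga does not vanish: if
    al(t_ga) = q_al ga(t_ga), then ga(C t_ga) = 2 ga(t_ga)^2 sum_al q_al^2. Hence it
    contains every x_ga, x_-ga and t_ga. *)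
Lemma casop_inj z : casop z = 0 -> z = 0.
Proof.
move=> z0; have zC y : B z (casop y) = 0.
  by rewrite -form_casop z0; exact: linear0f (form_linl HB y).
pose T ga := \sum_(al <- pos) (2%:R * al (hcoroot ga)) *: hcoroot al.
have TN0 ga : ga \in pos -> ga (T ga) != 0.
  move=> gP; set t := hcoroot ga.
  have qE al : exists q : rat, al \in pos -> al t = ratr q * ga t.
    case: (boolP (al \in pos)) => [aP|_]; last by exists 0.
    by have [q e] := root_string_ratio gP (pos_sub aP); exists q.
  have /choice [q qE'] := qE.
  have -> : ga (T ga) = 2%:R * (ga t) ^+ 2 * ratr (\sum_(al <- pos) q al ^+ 2).
    rewrite rmorph_sum mulr_sumr linear_sum big_seq [RHS]big_seq.
    apply: eq_bigr => al aP; rewrite linearZ /= -(form_coroot _ gP) (inv_form_sym HB).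
    rewrite vs_hcoroot // -(vs_hcoroot gP) form_coroot // -/t.
    rewrite -[LHS]/(_ * _ * _) (qE' al aP) rmorphXn /=; ring.
  apply: mulf_neq0.
    by rewrite mulf_neq0 ?pnatr_eq0 ?expf_neq0 ?root_coroot_neq0.
  rewrite fmorph_eq0.
  rewrite psumr_eq0; last by move=> al _; exact: sqr_ge0.
  apply/negP => /allP /(_ ga gP) /=; rewrite sqrf_eq0 => /eqP q0.
  have := qE' ga gP; rewrite q0 rmorph0 mul0r => t0.
  by have := root_coroot_neq0 gP; rewrite -/t t0 eqxx.
have xC ga : ga \in pos -> ga (T ga) *: x ga = casop (br (vsval (hcoroot ga)) (x ga)).
  by move=> gP; rewrite -casop_brl casop_h (rspaceP _ (xpos gP)).
have xCn ga : ga \in pos ->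
    ga (T ga) *: x (- ga) = - casop (br (vsval (hcoroot ga)) (x (- ga))).
  by move=> gP; rewrite -casop_brl casop_h (rspaceP _ (xneg gP)) opp_lfunE scaleNr opprK.
have zh : z \in h.
  apply: in_h_of_form => ga gP; apply: (mulfI (TN0 ga gP)).
    by rewrite mulr0 -[LHS](linearZf _ _ (form_linr HB z)) xC.
  rewrite mulr0 -[LHS](linearZf _ _ (form_linr HB z)).
  by rewrite xCn // (linearNf _ (form_linr HB z)) zC oppr0.
rewrite -(vsprojK zh); suff -> : vsproj h z = 0 by rewrite linear0.
apply: (pos_root_sep HS) => ga gP; apply: (mulfI (TN0 ga gP)); rewrite mulr0.
rewrite -(form_coroot (vsproj h z) gP) vsprojK // (inv_form_sym HB).
rewrite -[LHS](linearZf _ _ (form_linr HB z)) /coroot -brZl xC //.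
by rewrite casop_brl zC.
Qed.

Lemma casop_surj y : exists z, casop z = y.
Proof.
pose F : {linear a -> a} := HB.pack casop (GRing.isLinear.Build K a a _ casop casop_linear).
pose f := linfun F; have fE z : f z = casop z by rewrite lfunE.
have f0 : lker f == 0%VS.
  rewrite -subv0; apply/subvP => z; rewrite memv_ker fE memv0 => /eqP z0.
  by apply/eqP/casop_inj.
by exists ((f^-1)%VF y); rewrite -fE lker0_lfunVK.
Qed.

(** With m = sum_S [u, D v], invariance of S gives C(D y) = [y, m], so that
    D y = [y, C^-1 m]. *)
Lemma derivation_inner (D : a -> a) : linear D ->
  (forall y z, D (br y z) = br (D y) z + br y (D z)) ->
  exists z, forall y, D y = br z y.
Proof.
move=> Dl DM; pose m := tlift (fun u v => br u (D v)) symr.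
have bm : bilin (fun u v : a => br u (D v)).
  exact: (bilin_comp (bilin_br a) (@linear_id _ _) Dl).
have [z zE] := casop_surj m.
exists (- z) => y; rewrite brNl -br_anti; apply/eqP; rewrite -subr_eq0; apply/eqP.
apply: casop_inj; rewrite (linearDf _ _ casop_linear) (linearNf _ casop_linear).
rewrite -casop_br zE.
have := congr1 (tlift (fun u v : a => br u (D v))) (symr_inv y).
rewrite linear0 tlift_ad2 // => e.
apply/eqP; rewrite -oppr_eq0 opprB -e /m (linear_tlift _ _ (br_linr y)) /casop.
rewrite -tlift_opp -tlift_add; apply/eqP; apply: eq_tlift => u v.
rewrite [br y (br u _)]br_leibniz DM brDr -addrA; congr (_ + _).
by rewrite addrC; congr (_ + _); rewrite [br (D y) v]br_anti brNr.
Qed.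

(** Every element is of the form C z, a combination of brackets. *)
Lemma perfect (f : a -> K^o) : linear f ->
  (forall y z, f (br y z) = 0) -> forall y, f y = 0.
Proof.
move=> fl f0 y; have [z <-] := casop_surj y.
rewrite /casop (linear_tlift _ _ fl) -[RHS](tlift0 K^o symr).
by apply: eq_tlift.
Qed.

(** * Zeros of the cobracket *)

Lemma ctrE y : ctr B y r = vsval (ctrh y r0)
  + \sum_(al <- pos) B y (x (- al)) *: x al
  + \sum_(al <- pos) \sum_(be <- pos | `[< prec al be >])
      (B y (x (- al)) *: x be - B y (x be) *: x (- al)).
Proof.
have cl := ctr_linear B y; rewrite /BD_formula 2!(linearDf _ _ cl) ctr_h.
congr (_ + _ + _); rewrite (linear_sumf _ _ _ cl); apply: eq_bigr => al _.
  by rewrite (ctr_pure HB).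
rewrite (linear_sumf _ _ _ cl); apply: eq_bigr => be _.
by rewrite (linearDf _ _ cl) (linearNf _ cl) !(ctr_pure HB).
Qed.

Lemma sum_pos_eq (U : lmodType K) (F : dual (hsub h) -> U) (P : pred (dual (hsub h))) ga :
  ga \in pos -> P ga -> \sum_(be <- pos | P be) (be == ga)%:R *: F be = F ga.
Proof.
move=> gP Pg; rewrite (big_rem ga) //= Pg eqxx scale1r big_seq_cond big1 ?addr0 // => be.
rewrite (rem_filter ga (pos_uniq Delta HPhi)) mem_filter /= => /andP [/andP [/negbTE -> _] _].
by rewrite scale0r.
Qed.

(** Pairing with x_-ga reads off the coefficient of x_ga: the operator of r is
    unipotent, for the order on roots, on the span of the positive root vectors,
    and nilpotent on the span of the negative ones. *)
Lemma form_ctr_neg y ga : ga \in pos ->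
  B (ctr B y r) (x (- ga)) = B y (x (- ga))
    + \sum_(al <- pos | `[< prec al ga >]) B y (x (- al)) :> K^o.
Proof.
move=> gP; have fl := form_linl HB (x (- ga)).
rewrite ctrE !(linearDf _ _ fl) form_hxn // add0r; congr (_ + _).
  rewrite (linear_sumf _ _ _ fl) -[RHS](sum_pos_eq (fun al => B y (x (- al)) : K^o) (P := predT) gP) //.
  rewrite big_seq [RHS]big_seq; apply: eq_bigr => al aP; rewrite (linearZf _ _ fl) form_xx //.
  exact: mulrC.
rewrite (linear_sumf _ _ _ fl) [RHS]big_mkcond big_seq [RHS]big_seq.
apply: eq_bigr => al aP; rewrite (linear_sumf _ _ _ fl) big_seq_cond.
have E be : (be \in pos) && `[< prec al be >] ->
    B (B y (x (- al)) *: x be - B y (x be) *: x (- al)) (x (- ga))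
    = (be == ga)%:R *: (B y (x (- al)) : K^o).
  case/andP=> bP _; rewrite (linearDf _ _ fl) (linearNf _ fl) !(linearZf _ _ fl).
  by rewrite form_xx // form_xnn // scaler0 subr0; exact: mulrC.
under eq_bigr => be bP do rewrite (E be bP).
rewrite -big_seq_cond; case: ifP => pag; first exact: sum_pos_eq gP pag.
rewrite big1 // => be; have [->|_] := eqVneq be ga; first by rewrite pag.
by rewrite scale0r.
Qed.

Lemma form_ctr_pos y ga : ga \in pos ->
  B (ctr B y r) (x ga)
    = - \sum_(be <- pos | `[< prec ga be >]) B y (x be) :> K^o.
Proof.
move=> gP; have fl := form_linl HB (x ga).
rewrite ctrE !(linearDf _ _ fl) form_hx // add0r.
rewrite (linear_sumf _ _ _ fl) big_seq big1 ?add0r => [|al aP]; last first.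
  by rewrite (linearZf _ _ fl) form_xpp // scaler0.
rewrite (linear_sumf _ _ _ fl).
rewrite -[RHS](sum_pos_eq (fun al => - (\sum_(be <- pos | `[< prec al be >]) B y (x be)) : K^o) (P := predT) gP) //.
rewrite big_seq [RHS]big_seq; apply: eq_bigr => al aP.
rewrite -sumrN scaler_sumr (linear_sumf _ _ _ fl) big_seq_cond [RHS]big_seq_cond.
apply: eq_bigr => be /andP [bP _].
rewrite (linearDf _ _ fl) (linearNf _ fl) !(linearZf _ _ fl) form_xpp // scaler0 add0r.
rewrite (inv_form_sym HB (x (- al))) form_xx // eq_sym scalerN; congr (- _); exact: mulrC.
Qed.

Lemma coord_Delta (i j : 'I_l) : coord Delta i Delta`_j = (i == j)%:R.
Proof. by rewrite coord_free ?(Delta_free HS) // eq_sym. Qed.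

Lemma coord_tau_ext al i : i \in G1 ->
  coord Delta (tau i) (tau_ext Delta G1 tau al) = coord Delta i al.
Proof.
move=> iG; rewrite /tau_ext linear_sum (bigD1 i) //= big1 => [|j /andP [jG ji]].
  by rewrite addr0 linearZ /= coord_Delta eqxx mulr1.
rewrite linearZ /= coord_Delta; have [/(BD_inj HT)|_] := eqVneq (tau i) (tau j).
  by move=> /(_ iG jG) ij; rewrite ij eqxx in ji.
by rewrite mulr0.
Qed.

Lemma in_span_coord (G : {set 'I_l}) al i :
  in_span Delta G al -> i \notin G -> coord Delta i al = 0.
Proof.
case=> c -> iG; rewrite linear_sum big1 // => j jG.
rewrite -scaler_int linearZ /= coord_Delta; have [ij|_] := eqVneq i j; last by rewrite mulr0.
by rewrite ij jG in iG.
Qed.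

(** tau moves the coefficients along the simple roots, and the orbit of a simple
    root of Gamma_1 eventually leaves Gamma_1. *)
Lemma tau_ext_exits al : al != 0 ->
  exists n, ~ in_span Delta G1 (iter n (tau_ext Delta G1 tau) al).
Proof.
move=> aN0; have [i ci] : exists i, coord Delta i al != 0.
  apply: contrapT => nE; move/eqP: aN0; apply.
  rewrite (coord_basis (Delta_basis HS) (memvf al)) big1 // => i _.
  have [->|ci] := eqVneq (coord Delta i al) 0; first exact: scale0r.
  by case: nE; exists i.
have [iG|iG] := boolP (i \in G1); last first.
  by exists 0%N => /(in_span_coord)/(_ iG) /eqP; apply/negP.
have [n [_ nG]] := BD_nilp HT iG; rewrite inE => /andP [nG1 _].
exists n => /(in_span_coord) /(_ nG1).
suff E k : (k <= n)%N -> coord Delta (iter k tau i) (iter k (tau_ext Delta G1 tau) al)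
    = coord Delta i al by rewrite (E n) // => /eqP; apply/negP.
elim: k => [//|k IHk] kn; rewrite !iterS coord_tau_ext ?nG //.
exact: IHk (ltnW kn).
Qed.

(** The measure is the number of times tau can be applied. *)
Lemma prec_measure : exists mu : dual (hsub h) -> nat,
  forall al be, al \in pos -> be \in pos -> prec al be -> (mu be < mu al)%N.
Proof.
pose T := tau_ext Delta G1 tau.
have h1 al : exists n, al \in pos ->
    ~ in_span Delta G1 (iter n T al) /\
    forall m, ~ in_span Delta G1 (iter m T al) -> (n <= m)%N.
  have [aP|naP] := boolP (al \in pos); last by exists 0%N.
  have [aN0 _] := Phi_root HPhi (pos_sub aP).
  have ex : exists n, `[< ~ in_span Delta G1 (iter n T al) >].
    by have [n nE] := tau_ext_exits aN0; exists n; apply/asboolP.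
  exists (ex_minn ex) => _; case: ex_minnP => n /asboolP nE nmin; split=> // m mE.
  by apply: nmin; apply/asboolP.
have /choice [mu muE] := h1.
exists mu => al be aP bP [_ _ [n [n0 nG beE]]].
have [aout amin] := muE al aP; have [_ bmin] := muE be bP.
have le_n : (n <= mu al)%N by rewrite leqNgt; apply/negP => /nG.
apply: (@leq_ltn_trans (mu al - n)); last by rewrite -[X in (_ < X)%N]subn0 ltn_sub2l // (leq_trans n0).
by apply: bmin; rewrite beE -iterD subnK.
Qed.

Section Zeros.
Variable Z : a.
Hypothesis Zr : ad2 Z r = 0.

Lemma ctr_zero y : br Z (ctr B y r) = ctr B (br Z y) r.
Proof. by apply/eqP; rewrite -subr_eq0 -(ctr_ad HB) Zr (linear0f (ctr_linear B y)). Qed.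

Lemma ctr_hr H : ctr B (vsval H) r = vsval (ctrh (vsval H) r0).
Proof.
rewrite ctrE big_seq big1 ?addr0 => [|al aP]; last by rewrite (form_hxn H aP) scale0r.
rewrite big_seq big1 ?addr0 // => al aP; rewrite big_seq_cond big1 // => be /andP [bP _].
by rewrite (form_hxn H aP) (form_hx H bP) !scale0r subr0.
Qed.

(** Up to an antisymmetric part, r0 is half of Omega0, and the contraction of
    Omega0 is the identity on h. *)
Lemma ctrh_half ga : ga \in pos ->
  2%:R * ga (ctrh (vsval (hcoroot ga)) r0) = ga (hcoroot ga).
Proof.
move=> gP; have gl : linear (ga : hsub h -> K^o) by move=> c u v; rewrite linearP.
have gb : bilin (fun u v : hsub h => ga u *: ga v) by exact: bilin_scale.
have E s : ga (ctrh (vsval (hcoroot ga)) s) = tlift (fun u v => ga u *: ga v) s.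
  rewrite /ctrh [LHS](linear_tlift _ _ gl); apply: eq_tlift => u v.
  by rewrite linearZ /= vs_hcoroot // form_coroot.
rewrite -[in RHS](ctrh_Omega0 (hcoroot ga)) !E; case: Hr0 => _ <-.
rewrite linearD /= tlift_flip // mulr_natl mulr2n; congr (_ + _).
by apply: eq_tlift => u v; exact: mulrC.
Qed.

Lemma ctrh_ga_neq0 ga : ga \in pos -> ga (ctrh (vsval (hcoroot ga)) r0) != 0.
Proof.
move=> gP; have := root_coroot_neq0 gP; rewrite -ctrh_half //.
by apply: contraNneq => ->; rewrite mulr0.
Qed.

(** Both sides of [ctr_zero], applied to y = t_ga, are paired with x_-ga and
    with x_ga. By induction along the order the other root components of Z drop
    out, and the coefficient that is left is plus or minus ga(t_ga) / 2. *)
Lemma zero_in_h : Z \in h.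
Proof.
have [mu muE] := prec_measure; apply: in_h_of_form => ga; last first.
(* the terms B(Z, x_-al) with al below ga have a larger measure *)
- pose N := \max_(al <- pos) mu al.
  have [n] := ubnP (N - mu ga); elim: n ga => // n IHn ga ltn_ga gP.
  set t := hcoroot ga; set f0 := ctrh (vsval t) r0.
  have := congr1 (fun y => B y (x (- ga))) (ctr_zero (vsval t)).
  rewrite form_ctr_neg // ctr_hr big1_seq => [|al /andP [/asboolP ag aP]]; last first.
    rewrite (inv_form_inv HB) (rspaceP t (xneg aP)) (linearZf _ _ (form_linr HB Z)).
    have lt_ga : (mu ga < mu al)%N := muE _ _ aP gP ag.
    have le_al : (mu al <= N)%N by rewrite /N (big_rem al) //= leq_maxl.
    have lt_n : (N - mu al < n)%N.
      by apply: leq_trans (ltn_sub2l (leq_trans lt_ga le_al) lt_ga) _; rewrite -ltnS.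
    by rewrite (IHn _ lt_n aP) scaler0.
  rewrite addr0 !(inv_form_inv HB) !(rspaceP _ (xneg gP)) !opp_lfunE.
  rewrite !(linearZf _ _ (form_linr HB Z)) => /eqP; rewrite -subr_eq0.
  rewrite -[X in X == 0]/(- ga f0 * B Z (x (- ga)) - - ga t * B Z (x (- ga))) -mulrBl opprK.
  rewrite -[ga t]ctrh_half // mulr_natl mulr2n addrA addNr add0r.
  by rewrite mulf_eq0 (negbTE (ctrh_ga_neq0 gP)) => /eqP.
have [n] := ubnP (mu ga); elim: n ga => // n IHn ga ltn_ga gP.
set t := hcoroot ga.
have := congr1 (fun y => B y (x ga)) (ctr_zero (vsval t)).
rewrite form_ctr_pos // ctr_hr big1_seq => [|be /andP [/asboolP gb bP]]; last first.
  rewrite (inv_form_inv HB) (rspaceP t (xpos bP)) (linearZf _ _ (form_linr HB Z)).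
  by rewrite IHn ?scaler0 //; apply: leq_trans (muE _ _ gP bP gb) _; rewrite -ltnS.
rewrite oppr0 !(inv_form_inv HB) !(rspaceP _ (xpos gP)) (linearZf _ _ (form_linr HB Z)).
move/eqP; rewrite -[X in X == 0]/(ga (ctrh (vsval t) r0) * B Z (x ga)).
by rewrite mulf_eq0 (negbTE (ctrh_ga_neq0 gP)) => /eqP.
Qed.

(** Pairing [ctr_zero] at x_al with x_-be, where be = tau al, compares al(Z) and
    be(Z), both multiplied by the coefficient of x_be in the image of x_al. *)
Lemma zero_tau (i : 'I_l) : i \in G1 ->
  Delta`_i (vsproj h Z) = Delta`_(tau i) (vsproj h Z).
Proof.
move=> iG; set H := vsproj h Z; have ZH : vsval H = Z by rewrite vsprojK // zero_in_h.
set al := Delta`_i; set be := Delta`_(tau i).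
have aP : al \in pos := Delta_pos HS i; have bP : be \in pos := Delta_pos HS (tau i).
have sp (G : {set 'I_l}) j : j \in G -> in_span Delta G Delta`_j.
  move=> jG; exists (fun k => (k == j)%:Z); rewrite (bigD1 j) //= eqxx mulr1z big1 ?addr0 //.
  by move=> k /andP [_ /negbTE ->]; rewrite mulr0z.
have tG : tau i \in G2 by rewrite -(BD_surj HT) imset_f.
have pab : prec al be.
  split; [by split=> //; exact: sp | by split=> //; exact: sp |].
  exists 1%N; split=> // [[|k] //= _|]; first exact: sp.
  rewrite /= /tau_ext (bigD1 i) //= coord_Delta eqxx scale1r big1 ?addr0 // => j /andP [_ ji].
  by rewrite coord_Delta (negbTE ji) scale0r.
have := congr1 (fun y => B y (x (- be))) (ctr_zero (x al)).
rewrite -{2}ZH (rspaceP H (xpos aP)) (linearZf _ _ (ctr_linl HB r)).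
rewrite (linearZf _ _ (form_linl HB _)) (form_brl HB) -ZH (rspaceP H (xneg bP)).
rewrite opp_lfunE (linearZf _ _ (form_linr HB _)) scaleNr opprK form_ctr_neg //.
have -> : \sum_(al' <- pos | `[< prec al' be >]) B (x al) (x (- al')) = 1 :> K^o.
  transitivity (\sum_(al' <- pos | `[< prec al' be >]) (al' == al)%:R *: (1 : K^o)).
    rewrite big_seq_cond [RHS]big_seq_cond; apply: eq_bigr => al' /andP [a'P _].
    by rewrite form_xx // eq_sym -[RHS]/(_ * _) mulr1.
  by rewrite (sum_pos_eq (fun _ => 1 : K^o) (P := fun al' => `[< prec al' be >]) aP) //; exact/asboolT.
(* this coefficient is 1 when al and be differ and would be 2 otherwise *)
have cN0 : (al == be)%:R + 1 != 0 :> K by rewrite natr1 pnatr_eq0.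
rewrite form_xx // => E; apply: (mulIf cN0); exact: esym E.
Qed.

End Zeros.
End BDData.

Theorem BD_structure (K : numFieldType) (a : lieAlg K) (h : {vspace a}) (l : nat)
    (Delta : l.-tuple (dual (hsub h))) (G1 G2 : {set 'I_l}) (tau : 'I_l -> 'I_l)
    (r : tens a a) :
  BD_rmatrix Delta G1 G2 tau r -> (forall y, flip (ad2 y r) = - ad2 y r) ->
  [/\ forall z : a, (forall y, br y z = 0) -> z = 0,
      forall f : a -> K^o, linear f -> (forall y z, f (br y z) = 0) -> forall y, f y = 0,
      forall t : tens a a, flip t = - t -> (forall y, ad2 y t = 0) -> t = 0,
      forall D : a -> a, linear D ->
        (forall y z, D (br y z) = br (D y) z + br y (D z)) ->
        exists z, forall y, D y = br z y
    & (forall y z, y \in h -> z \in h -> br y z = 0) /\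
      forall Z, ad2 Z r = 0 -> Z \in h /\ forall i : 'I_l, i \in G1 ->
        Delta`_i (vsproj h Z) = Delta`_(tau i) (vsproj h Z)].
Proof.
case=> [B [Phi [r0 [x [[HB hC HPhi] [HS HT Hr0 Hx ->]]]]]] Hr.
have ct := centreless HB hC HPhi HS Hx.
split=> //.
- exact: perfect HB hC HPhi HS Hr0 Hx Hr.
- by apply: (no_antisym_invariants HB); rewrite ?pnatr_eq0.
- exact: derivation_inner HB hC HPhi HS Hr0 Hx Hr.
- split=> [y z|Z Zr]; first exact: (cartan_abelian hC).
split=> [|i iG]; [exact: (zero_in_h HB hC HPhi HS HT Hr0 Hx Hr Zr) | exact: (zero_tau HB hC HPhi HS HT Hr0 Hx Hr Zr iG)].
Qed.

(** * Complexification *)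

Section Complexification.
Variable R : realType.
Local Notation C := R[i].
Implicit Types V W : vectType R.

Lemma cplx_ext V (U : lmodType C) (F : cplx V -> U) : linear F ->
  (forall x, F (toC x) = 0) -> forall u, F u = 0.
Proof.
move=> Fl F0 u; rewrite [u]cplx_sum (linear_sumf _ _ _ Fl) big1 // => i _.
by rewrite (linearZf _ _ Fl) F0 scaler0.
Qed.

Lemma toC_eq0 V (x : V) : toC x = 0 -> x = 0.
Proof.
move/rowP => x0; apply: ecoordP => i; rewrite [RHS](linear0f (ecoord_linear i)).
by have := x0 i; rewrite !mxE => /eqP; rewrite fmorph_eq0 => /eqP.
Qed.

Lemma cmap_linear V W (f : V -> W) : linear (cmap f).
Proof. exact: clift_linear. Qed.

Lemma cmap_toC V W (f : V -> W) x : linear f -> cmap f (toC x) = toC (f x).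
Proof. exact: clift_toC. Qed.

Lemma toC2_sum V W (t : tens V W) : toC2 t
  = \sum_i \sum_j ((t : 'M_(_, _)) i j)%:C%C *: pure (toC (ebase i)) (toC (ebase j)).
Proof. by []. Qed.

Lemma toC2D V W (s t : tens V W) : toC2 (s + t) = toC2 s + toC2 t.
Proof.
rewrite !toC2_sum -big_split; apply: eq_bigr => i _; rewrite -big_split.
by apply: eq_bigr => j _; rewrite mxE rmorphD scalerDl.
Qed.

Lemma toC2Z V W c (t : tens V W) : toC2 (c *: t) = c%:C%C *: toC2 t.
Proof.
rewrite !toC2_sum scaler_sumr; apply: eq_bigr => i _; rewrite scaler_sumr.
by apply: eq_bigr => j _; rewrite mxE rmorphM scalerA.
Qed.

Lemma toC20 V W : toC2 (0 : tens V W) = 0.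
Proof. by rewrite -[0 in LHS](scale0r (0 : tens V W)) toC2Z rmorph0 scale0r. Qed.

Lemma toC2N V W (t : tens V W) : toC2 (- t) = - toC2 t.
Proof. by rewrite -scaleN1r toC2Z rmorphN rmorph1 scaleN1r. Qed.

Lemma toC2_bigsum V W I (s : seq I) (P : pred I) (F : I -> tens V W) :
  toC2 (\sum_(i <- s | P i) F i) = \sum_(i <- s | P i) toC2 (F i).
Proof. exact: (big_morph _ (@toC2D V W) (toC20 V W)). Qed.

Lemma toC2_pure V W (v : V) (w : W) : toC2 (pure v w) = pure (toC v) (toC w).
Proof.
have bp := bilin_pure (cplx V) (cplx W).
rewrite toC2_sum {2}[v]ebase_sum toC_sum (linear_sumf _ _ _ (bp.1 _)).
apply: eq_bigr => i _; rewrite {2}[w]ebase_sum toC_sum (linear_sumf _ _ _ (bp.2 _)).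
by apply: eq_bigr => j _; rewrite !toCZ pureZl pureZr mxE rmorphM scalerA.
Qed.

Lemma toC2_wedge V (v w : V) : toC2 (wedge v w) = wedge (toC v) (toC w).
Proof. by rewrite /wedge toC2D toC2N !toC2_pure. Qed.

(** Pure tensors of real vectors span, so comparing on them is enough. *)
Lemma toC2_tlift V W V' W' (b : V -> W -> tens V' W')
    (F : tens (cplx V) (cplx W) -> tens (cplx V') (cplx W')) t :
  linear F -> (forall v w, F (pure (toC v) (toC w)) = toC2 (b v w)) ->
  toC2 (tlift b t) = F (toC2 t).
Proof.
move=> Fl Fb; rewrite toC2_bigsum toC2_sum (linear_sumf _ _ _ Fl).
apply: eq_bigr => i _; rewrite toC2_bigsum (linear_sumf _ _ _ Fl).
by apply: eq_bigr => j _; rewrite toC2Z (linearZf _ _ Fl) Fb.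
Qed.

Lemma toC2_flip V (t : tens V V) : toC2 (flip t) = flip (toC2 t).
Proof.
apply: toC2_tlift => [|v w]; first exact: flip_linear.
by rewrite flip_pure toC2_pure.
Qed.

Lemma toC2_tmap V W (f : V -> W) t : linear f ->
  toC2 (tmap f f t) = tmap (cmap f) (cmap f) (toC2 t).
Proof.
move=> fl; apply: toC2_tlift => [|v w]; first exact: tmap_linear.
by rewrite (tmap_pure _ _ (cmap_linear f) (cmap_linear f)) !cmap_toC // toC2_pure.
Qed.

Lemma toC2_ad2 (g : lieAlg R) (x : g) t :
  toC2 (ad2 x t) = ad2 (toC x : cplx_lie g) (toC2 t).
Proof.
apply: (toC2_tlift _ (@ad2_linear _ (cplx_lie g) (toC x))) => v w.
by rewrite (ad2_pure (toC x : cplx_lie g)) /= !cbr_toC toC2D !toC2_pure.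
Qed.

Lemma toC2_eq0 V (t : tens V V) : toC2 t = 0 -> t = 0.
Proof.
move=> t0; apply/matrixP => i j; rewrite [RHS]mxE.
pose p k (u : cplx V) : C^o := (u : 'rV_(_)) 0 k.
have pl k : linear (p k) by move=> c u v; rewrite /p !mxE.
have pb : bilin (fun u v : cplx V => p i u *: p j v) by exact: bilin_scale.
have pE k m : p k (toC (ebase m)) = (k == m)%:R by rewrite /p mxE ecoord_ebase rmorph_nat.
have := congr1 (tlift (fun u v : cplx V => p i u *: p j v)) t0.
rewrite linear0 toC2_sum (linear_sumf _ _ _ (@tlift_linear _ _ _ _ _)) (bigD1 i) //=.
rewrite [X in _ + X]big1 ?addr0 => [|k /negbTE ki]; last first.
  rewrite (linear_sumf _ _ _ (@tlift_linear _ _ _ _ _)) big1 // => m _.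
  by rewrite (linearZf _ _ (@tlift_linear _ _ _ _ _)) tliftP // !pE eq_sym ki scale0r scaler0.
rewrite (linear_sumf _ _ _ (@tlift_linear _ _ _ _ _)) (bigD1 j) //=.
rewrite big1 ?addr0 => [|m /negbTE mj]; last first.
  by rewrite (linearZf _ _ (@tlift_linear _ _ _ _ _)) tliftP // !pE [j == m]eq_sym mj !scaler0.
rewrite (linearZf _ _ (@tlift_linear _ _ _ _ _)) tliftP // !pE !eqxx.
rewrite -[LHS]/(_ * (_ * _)) !mulr1 => /eqP; rewrite fmorph_eq0; exact: eqP.
Qed.

Lemma cmap_br (g g' : lieAlg R) (f : g -> g') : linear f ->
  (forall x y, f (br x y) = br (f x) (f y)) ->
  forall u v : cplx_lie g, cmap f (br u v) = br (cmap f u : cplx_lie g') (cmap f v).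
Proof.
move=> fl fM u v; apply/eqP; rewrite -subr_eq0; apply/eqP; move: u.
apply: cplx_ext => [|x].
  apply: linear_sub; first exact: linear_comp (cmap_linear f) (@br_linl _ (cplx_lie g) v).
  exact: linear_comp (@br_linl _ (cplx_lie g') _) (cmap_linear f).
move: v; apply: cplx_ext => [|y].
  apply: linear_sub; first exact: linear_comp (cmap_linear f) (@br_linr _ (cplx_lie g) _).
  exact: linear_comp (@br_linr _ (cplx_lie g') _) (cmap_linear f).
by rewrite /= cbr_toC !cmap_toC // cbr_toC fM subrr.
Qed.

End Complexification.

(** * Descent from the complexification *)

Section Descent.
Variables (R : realType) (g : lieAlg R).
Local Notation C := R[i].
Local Notation gC := (cplx_lie g).

Lemma descend_centreless :
  (forall z : gC, (forall u, br u z = 0) -> z = 0) ->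
  forall z : g, (forall x, br x z = 0) -> z = 0.
Proof.
move=> ct z zc; apply: toC_eq0; apply: ct; apply: cplx_ext => [|x].
  exact: (@br_linl _ gC).
by rewrite /= cbr_toC zc toC0.
Qed.

Lemma descend_perfect :
  (forall f : gC -> C^o, linear f -> (forall u v, f (br u v) = 0) -> forall u, f u = 0) ->
  forall f : g -> R^o, linear f -> (forall x y, f (br x y) = 0) -> forall x, f x = 0.
Proof.
move=> pf f fl f0 x; pose F : gC -> C^o := clift (fun x => (f x)%:C%C : C^o).
have Fl : linear F by exact: clift_linear.
have FE y : F (toC y) = (f y)%:C%C.
  rewrite /F /clift [in RHS](ebase_sum y) (linear_sumf _ _ _ fl) rmorph_sum /=.
  by apply: eq_bigr => i _; rewrite (linearZf _ _ fl) mxE; exact: esym (rmorphM _ _ _).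
suff /eqP : F (toC x) = 0 by rewrite FE fmorph_eq0 => /eqP.
apply: (pf _ Fl) => u v; move: u; apply: cplx_ext => [|y].
  exact: linear_comp Fl (@br_linl _ gC v).
move: v; apply: cplx_ext => [|z]; first exact: linear_comp Fl (@br_linr _ gC _).
by rewrite /= cbr_toC FE f0 rmorph0.
Qed.

Lemma descend_noinv :
  (forall t : tens gC gC, flip t = - t -> (forall u, ad2 u t = 0) -> t = 0) ->
  forall t : tens g g, flip t = - t -> (forall x, ad2 x t = 0) -> t = 0.
Proof.
move=> ni t ta ti; apply: toC2_eq0; apply: ni; first by rewrite -toC2_flip ta toC2N.
apply: cplx_ext => [|x]; first exact: (@ad2_linl _ gC).
by rewrite -toC2_ad2 ti toC20.
Qed.

(** The real part, which is linear over the reals and commutes with brackets by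
    real elements, turns an implementing element of a real derivation into a
    real one. *)
Definition cRe (u : gC) : g := \sum_i complex.Re ((u : 'rV_(_)) 0 i) *: ebase i.

Lemma cRe_toC x : cRe (toC x) = x.
Proof. by rewrite [RHS]ebase_sum; apply: eq_bigr => i _; rewrite mxE. Qed.

Lemma cRe_br (w : gC) x : cRe (br w (toC x)) = br (cRe w) x.
Proof.
apply: ecoordP => k.
rewrite [LHS]ecoord_lincomb [in LHS](cplx_sum w) sum_brl sum_brl summxE.
rewrite (linear_sumf _ _ _ (ecoord_linear k)).
have ReS I (s : seq I) (F : I -> C) : complex.Re (\sum_(i <- s) F i) = \sum_(i <- s) complex.Re (F i).
  by apply: (big_morph (@complex.Re R)) => [[? ?] [? ?]|].
rewrite ReS; apply: eq_bigr => i _; rewrite !brZl (linearZf _ _ (ecoord_linear k)) /= cbr_toC !mxE.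
by case: ((w : 'rV_(_)) 0 i) => p q /=; rewrite mulr0 subr0.
Qed.

Lemma descend_inner :
  (forall D : gC -> gC, linear D ->
     (forall u v, D (br u v) = br (D u) v + br u (D v)) ->
     exists z, forall u, D u = br z u) ->
  forall D : g -> g, linear D ->
    (forall x y, D (br x y) = br (D x) y + br x (D y)) ->
    exists z, forall x, D x = br z x.
Proof.
move=> inn D Dl DM; have cl := cmap_linear D.
have [|z zE] := inn (cmap D) cl.
  move=> u v; apply/eqP; rewrite -subr_eq0; apply/eqP; move: u.
  apply: cplx_ext => [|x].
    apply: linear_sub; first exact: linear_comp cl (@br_linl _ gC v).
    apply: linear_add; first exact: linear_comp (@br_linl _ gC v) cl.
    exact: (@br_linl _ gC).
  move: v; apply: cplx_ext => [|y].
    apply: linear_sub; first exact: linear_comp cl (@br_linr _ gC _).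
    apply: linear_add; first exact: (@br_linr _ gC).
    exact: linear_comp (@br_linr _ gC _) cl.
  by rewrite /= cbr_toC !cmap_toC // !cbr_toC DM toCD subrr.
by exists (cRe z) => x; rewrite -cRe_br -zE cmap_toC // cRe_toC.
Qed.

End Descent.

(** * Cobrackets on the product with an abelian algebra *)

Lemma ad2_correction (K : fieldType) (g : lieAlg K) (d d0 : nat)
    (H : 'I_d0 -> g) (t : 'I_d0 -> kvec K d) (x : g) :
  ad2 (inG (kvec K d) x) (\sum_i wedge (inG (kvec K d) (H i)) (inV g (t i)))
  = - \sum_i wedge (inG (kvec K d) (br (H i) x)) (inV g (t i)).
Proof.
set L := lie_prod_abelian g (kvec K d).
rewrite (linear_sumf _ _ _ (@ad2_linear K L _)) -sumrN; apply: eq_bigr => i _.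
rewrite ad2_wedge -wedgeNl.
have -> : br (inG (kvec K d) x) (inV g (t i)) = 0 :> L by congr pair; rewrite /= br0r.
rewrite (linear0f ((bilin_wedge L).2 _)) addr0; congr wedge.
by congr pair; rewrite /= ?oppr0 // [LHS]br_anti.
Qed.

Theorem proposition3p13 (R : realType) :
  (* K = C *)
  (forall (g : lieAlg R[i]) (d : nat) (V := kvec R[i] d)
      (L := lie_prod_abelian g V) (delta : L -> tens L L)
      (h : {vspace g}) (l : nat) (Delta : l.-tuple (dual (hsub h)))
      (G1 G2 : {set 'I_l}) (tau : 'I_l -> 'I_l) (r : tens g g),
    semisimple g ->
    lie_bialgebra delta ->
    factorizable (delta_g delta) ->
    BD_rmatrix Delta G1 G2 tau r ->
    (forall x : g, delta_g delta x = ad2 x r) ->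
    exists (t : d.-tuple V) (d0 : nat) (H : d0.-tuple g) (deltaV : V -> tens V V),
      [/\ basis_of {:V}%VS t, (d0 <= d)%N & free H] /\
      (forall i : 'I_d0, H`_i \in h) /\
      (forall (k : 'I_l) (i : 'I_d0), k \in G1 ->
         Delta`_k (vsproj h H`_i) = Delta`_(tau k) (vsproj h H`_i)) /\
      (forall x : g,
         delta (inG V x) =
           tmap (@inG _ g V) (@inG _ g V) (delta_g delta x)
           + \sum_(i < d0) wedge (inG V (br H`_i x)) (inV g t`_i)
         /\
         delta (inG V x) =
           ad2 (inG V x) (tmap (@inG _ g V) (@inG _ g V) r
                          - \sum_(i < d0) wedge (inG V H`_i) (inV g t`_i))) /\
      [/\ lie_coalgebra deltaV,
          forall v : V,
            delta (inV g v) = tmap (@inV _ g V) (@inV _ g V) (deltaV v)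
        & forall i : 'I_d0, deltaV t`_i = 0])
  /\
  (* K = R *)
  (forall (g : lieAlg R) (d : nat) (V := kvec R d)
      (L := lie_prod_abelian g V) (delta : L -> tens L L)
      (gC := cplx_lie g) (LC := cplx_lie L)
      (h : {vspace gC}) (l : nat) (Delta : l.-tuple (dual (hsub h)))
      (G1 G2 : {set 'I_l}) (tau : 'I_l -> 'I_l) (r : tens gC gC),
    semisimple g ->
    lie_bialgebra delta ->
    factorizable (delta_g delta) \/ almost_factorizable (delta_g delta) ->
    BD_rmatrix Delta G1 G2 tau r ->
    (forall x : g, toC2 (delta_g delta x) = ad2 (toC x : gC) r) ->
    exists (t : d.-tuple V) (d0 : nat) (H : d0.-tuple g) (deltaV : V -> tens V V),
      [/\ basis_of {:V}%VS t, (d0 <= d)%N & free H] /\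
      (forall i : 'I_d0, (toC H`_i : gC) \in h) /\
      (forall (k : 'I_l) (i : 'I_d0), k \in G1 ->
         Delta`_k (vsproj h (toC H`_i)) = Delta`_(tau k) (vsproj h (toC H`_i))) /\
      (forall x : g,
         delta (inG V x) =
           tmap (@inG _ g V) (@inG _ g V) (delta_g delta x)
           + \sum_(i < d0) wedge (inG V (br H`_i x)) (inV g t`_i)
         /\
         toC2 (delta (inG V x)) =
           ad2 (toC (inG V x) : LC)
             (tmap (cmap (@inG _ g V) : gC -> LC) (cmap (@inG _ g V) : gC -> LC) r
              - \sum_(i < d0) wedge (toC (inG V H`_i) : LC) (toC (inV g t`_i)))) /\
      [/\ lie_coalgebra deltaV,
          forall v : V,
            delta (inV g v) = tmap (@inV _ g V) (@inV _ g V) (deltaV v)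
        & forall i : 'I_d0, deltaV t`_i = 0]).
Proof.
split=> [g d V L delta h l Delta G1 G2 tau r _ bialg _ BD dr
        |g d V L delta gC LC h l Delta G1 G2 tau r _ bialg _ BD dr].
  have Hr y : flip (ad2 y r) = - ad2 y r by rewrite -dr delta_g_anti.
  have [ct pf ni inn [hab zer]] := BD_structure BD Hr.
  have zc x y : delta_g delta x = 0 -> delta_g delta y = 0 -> br x y = 0.
    by rewrite !dr => /zer [xh _] /zer [yh _]; exact: hab.
  have [t [d0 [H [tH H0 dG dV V0]]]] := product_structure bialg ct pf ni inn zc.
  have zH (i : 'I_d0) : H`_i \in h /\ forall k : 'I_l, k \in G1 ->
      Delta`_k (vsproj h H`_i) = Delta`_(tau k) (vsproj h H`_i).
    by apply: zer; rewrite -dr.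
  exists t, d0, H, (deltaV delta); split=> //.
  split=> [i|]; first exact: (zH i).1.
  split=> [k i kG|]; first exact: (zH i).2.
  split=> [x|]; last by split=> //; exact: deltaV_coalgebra.
  split; first exact: dG.
  rewrite linearB /= ad2_correction opprK dG dr.
  by rewrite (tmap_ad2 _ _ (@inG_linear _ g d)).
have Hr (y : gC) : flip (ad2 y r) = - ad2 y r.
  apply/eqP; rewrite -subr_eq0 opprK; apply/eqP; move: y.
  apply: cplx_ext => [|y].
    apply: linear_add; last exact: (@ad2_linl _ gC).
    exact: linear_comp (@flip_linear _ gC) (@ad2_linl _ gC r).
  by rewrite -dr -toC2_flip delta_g_anti // toC2N addNr.
have [ctC pfC niC innC [hab zer]] := BD_structure BD Hr.
have ct := descend_centreless ctC; have pf := descend_perfect pfC.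
have ni := descend_noinv niC; have inn := descend_inner innC.
have zer' x : delta_g delta x = 0 -> ad2 (toC x : gC) r = 0.
  by move=> x0; rewrite -dr x0 toC20.
have zc x y : delta_g delta x = 0 -> delta_g delta y = 0 -> br x y = 0.
  move=> /zer' /zer [xh _] /zer' /zer [yh _]; apply: toC_eq0.
  by rewrite -cbr_toC; exact: hab.
have [t [d0 [H [tH H0 dG dV V0]]]] := product_structure bialg ct pf ni inn zc.
have zH (i : 'I_d0) : (toC H`_i : gC) \in h /\ forall k : 'I_l, k \in G1 ->
    Delta`_k (vsproj h (toC H`_i)) = Delta`_(tau k) (vsproj h (toC H`_i)).
  by apply: zer; exact: zer'.
exists t, d0, H, (deltaV delta); split=> //.
split=> [i|]; first exact: (zH i).1.
split=> [k i kG|]; first exact: (zH i).2.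
split=> [x|]; last by split=> //; exact: deltaV_coalgebra.
split; first exact: dG.
have iGl := @inG_linear _ g d.
have -> : \sum_(i < d0) wedge (toC (inG V H`_i) : LC) (toC (inV g t`_i))
    = toC2 (\sum_(i < d0) wedge (inG V H`_i) (inV g t`_i)).
  by rewrite toC2_bigsum; apply: eq_bigr => i _; rewrite toC2_wedge.
rewrite linearB /= -toC2_ad2 ad2_correction toC2N opprK.
rewrite -(cmap_toC x iGl).
have cM : forall u v : gC, cmap (@inG _ g V) (br u v) = br (cmap (@inG _ g V) u : LC) (cmap (@inG _ g V) v).
  exact: cmap_br.
rewrite -(tmap_ad2 (g := gC) (g' := LC) _ _ (cmap_linear _) cM) -dr -(toC2_tmap _ iGl) -toC2D.
by rewrite dG.
Qed.
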